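(* For every $n\in\mathbb{N}_0$, $$\lim_{\kappa\to0^+}\frac{E_n(\kappa)}{\kappa^2}=2n+1.$$
   Context: For $\kappa>0$, $H_\kappa=\Delta+v_\kappa$ is the self-adjoint operator on $\ell^2(\mathbb{Z})$ with $(\Delta f)(x)=2f(x)-f(x+1)-f(x-1)$ and $v_\kappa(x)=\kappa^4x^2$ acting as a multiplication operator; it has purely discrete spectrum. $E_n(\kappa)$ denotes its $n$-th eigenvalue counted with multiplicity, $n=0,1,2,\dots$. *)

(* Defs.v *)
From Stdlib Require Import Reals ZArith.
From Coquelicot Require Import Coquelicot.
Open Scope R_scope.

Definition Hk (k : R) (f : Z -> R) (x : Z) : R :=
  2 * f x - f (x + 1)%Z - f (x - 1)%Z + k ^ 4 * (IZR x) ^ 2 * f x.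

Definition l2 (f : Z -> R) : Prop :=
  ex_series (fun m : nat => (f (Z.of_nat m)) ^ 2) /\
  ex_series (fun m : nat => (f (- Z.of_nat m)%Z) ^ 2).

Definition eigenvector (k : R) (f : Z -> R) (mu : R) : Prop :=
  l2 f /\ (exists x, f x <> 0) /\ forall x, Hk k f x = mu * f x.

Definition lin_indep (m : nat) (f : nat -> Z -> R) : Prop :=
  forall c : nat -> R,
    (forall x, sum_f_R0 (fun i => c i * f i x) m = 0) ->
    forall i, (i <= m)%nat -> c i = 0.

(* there are at least n+1 eigenvalues (counted with multiplicity) <= lam,
   i.e. n+1 linearly independent eigenvectors with eigenvalues <= lam *)
Definition count_ge (k : R) (n : nat) (lam : R) : Prop :=
  exists (f : nat -> Z -> R) (mu : nat -> R),
    lin_indep n f /\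
    forall i, (i <= n)%nat -> eigenvector k (f i) (mu i) /\ mu i <= lam.

(* E_n(kappa): the n-th eigenvalue (from 0) counted with multiplicity *)
Definition E (n : nat) (k : R) : R := real (Glb_Rbar (count_ge k n)).

(* Main.v *)
(* Put k = kappa. The operator is compared, on the window |x| <= k^(-5/4), with an exactly solvable
   one: the Krawtchouk (spin-j) matrix with j + 1/2 close to k^-2. Written through the lowering
   operator b = a_1 - a_2 of two bosonic modes, that matrix is b^* b, and [b, b^*] = 2 yields its
   spectrum 0, 2, 4, ... together with its eigenvectors. On the other hand |b f|^2 / (j + 1/2) is,
   up to a shift by |f|^2 / (j + 1/2), the form of Delta + x^2 / (j + 1/2)^2 as long as x is small
   compared with j. Since functions of energy O(k^2) live at scale 1/k, cutting them off at
   k^(-5/4) costs o(k^2), and the variational principle transfers the levels (2n + 1) k^2 both ways.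
   Eigenvectors of the full operator are limits of eigenvectors of its Dirichlet truncations to
   [-N, N]; no mass is lost because k^4 sum x^2 f(x)^2 is bounded by the energy. *)
Require Import Defs.
From Stdlib Require Import Reals ZArith Lra Lia Classical ClassicalEpsilon.
From Coquelicot Require Import Coquelicot.
From mathcomp Require filter.
Open Scope R_scope.

(** The choice of j comes from the bond weight sqrt(1 - t) with t = ((x + 1/2) / (j + 1/2))^2: its
    defect is about t / 2, and t / 2 charged to both ends of every bond amounts to the potential x^2
    / (j + 1/2)^2 up to a constant, which is k^4 x^2 when j + 1/2 = k^-2. The shift by |f|^2 is the
    zero-point energy; it is what separates 2n + 1 from 2n. The cutoff radius must be large against
    1/k, so that the lost mass and the slope of the cutoff are negligible, and small against k^-2,
    where the bond weights leave the quadratic regime; k^(-5/4) lies in between, and k = s^4 makes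
    all powers integral, with relative errors of order s. [E] is the infimum of a set described by
    actual eigenvectors. A lower bound may take them as given, but an upper bound has to produce n +
    1 of them, and trial functions alone do not. This is why truncated operators, whose forms attain
    their minima, and a compactness argument enter in that direction. *)

(** * Finite sums over initial segments of the naturals *)

Fixpoint sumn (n : nat) (f : nat -> R) : R :=
  match n with O => 0 | S p => sumn p f + f p end.

Lemma sumn_ext (n : nat) (f g : nat -> R) :
  (forall i, (i < n)%nat -> f i = g i) -> sumn n f = sumn n g.
Proof.
induction n as [|n IH]; intros H; simpl; [easy|].
rewrite IH, H; [easy|lia|intros; apply H; lia].
Qed.

Lemma sumn_plus (n : nat) (f g : nat -> R) :
  sumn n (fun i => f i + g i) = sumn n f + sumn n g.
Proof. induction n as [|n IH]; simpl; [ring|rewrite IH; ring]. Qed.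

Lemma sumn_scal (n : nat) (a : R) (f : nat -> R) :
  sumn n (fun i => a * f i) = a * sumn n f.
Proof. induction n as [|n IH]; simpl; [ring|rewrite IH; ring]. Qed.

Lemma sumn_zero (n : nat) (f : nat -> R) :
  (forall i, (i < n)%nat -> f i = 0) -> sumn n f = 0.
Proof.
induction n as [|n IH]; intros H; simpl; [easy|].
rewrite IH, H; [ring|lia|intros; apply H; lia].
Qed.

Lemma sumn_le (n : nat) (f g : nat -> R) :
  (forall i, (i < n)%nat -> f i <= g i) -> sumn n f <= sumn n g.
Proof.
induction n as [|n IH]; intros H; simpl; [lra|].
apply Rplus_le_compat; [apply IH; intros|]; apply H; lia.
Qed.

Lemma sumn_ge0 (n : nat) (f : nat -> R) :
  (forall i, (i < n)%nat -> 0 <= f i) -> 0 <= sumn n f.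
Proof.
intros H; rewrite <- (sumn_zero n (fun _ => 0)) by easy; now apply sumn_le.
Qed.

Lemma sumn_term_le (n p : nat) (f : nat -> R) :
  (p < n)%nat -> (forall i, (i < n)%nat -> 0 <= f i) -> f p <= sumn n f.
Proof.
induction n as [|n IH]; intros Hp H; simpl; [lia|].
assert (H0 : 0 <= f n) by (apply H; lia).
destruct (Nat.eq_dec p n) as [->|Hne].
- assert (0 <= sumn n f) by (apply sumn_ge0; intros; apply H; lia); lra.
- assert (f p <= sumn n f) by (apply IH; [lia|intros; apply H; lia]); lra.
Qed.

Lemma sumn_single (n p : nat) (f : nat -> R) :
  (p < n)%nat -> (forall i, (i < n)%nat -> i <> p -> f i = 0) -> sumn n f = f p.
Proof.
induction n as [|n IH]; intros Hp H; simpl; [lia|].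
destruct (Nat.eq_dec p n) as [->|Hne].
- rewrite sumn_zero; [ring|intros; apply H; lia].
- rewrite IH, (H n); [ring|lia|lia|lia|intros; apply H; lia].
Qed.

Lemma sumn_head (n : nat) (f : nat -> R) :
  sumn (S n) f = f O + sumn n (fun i => f (S i)).
Proof. induction n as [|n IH]; simpl in *; [ring|rewrite IH; ring]. Qed.

Lemma sumn_exchange (n m : nat) (f : nat -> nat -> R) :
  sumn n (fun i => sumn m (f i)) = sumn m (fun l => sumn n (fun i => f i l)).
Proof.
induction n as [|n IH]; simpl.
- now rewrite sumn_zero.
- now rewrite IH, <- sumn_plus.
Qed.

Lemma sumn_mul (n m : nat) (f g : nat -> R) :
  sumn n f * sumn m g = sumn n (fun i => sumn m (fun l => f i * g l)).
Proof.
induction n as [|n IH]; simpl; [ring|].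
rewrite <- IH, sumn_scal; ring.
Qed.

Lemma sum_f_R0_sumn (n : nat) (f : nat -> R) : sum_f_R0 f n = sumn (S n) f.
Proof. induction n as [|n IH]; simpl in *; [ring|rewrite IH; ring]. Qed.

(** * Homogeneous linear systems *)

(** Gaussian elimination on the last unknown: a row with non-zero last coefficient serves as pivot,
    and if there is none the last unit vector is a solution. This is the dimension count behind each
    min-max step: n orthogonality conditions leave a non-zero combination of n + 1 vectors. *)
Lemma linear_system_nontrivial (n : nat) (A : nat -> nat -> R) :
  exists c : nat -> R, (exists i, (i <= n)%nat /\ c i <> 0) /\
    forall l, (l < n)%nat -> sumn (S n) (fun i => A l i * c i) = 0.
Proof.
revert A; induction n as [|n IH]; intros A.
{ exists (fun _ => 1); split; [exists O; split; [lia|lra]|intros; lia]. }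
destruct (classic (exists p, (p < S n)%nat /\ A p (S n) <> 0)) as [(p & Hp & HA)|Hno].
(* [skip] enumerates the rows other than the pivot row p. *)
- set (skip := fun l => if (l <? p)%nat then l else S l).
  destruct (IH (fun l i => A (skip l) i - A (skip l) (S n) / A p (S n) * A p i))
    as (c & (i0 & Hi0 & Hc0) & Hc).
  set (z := - sumn (S n) (fun i => A p i * c i) / A p (S n)).
  exists (fun i => if (i =? S n)%nat then z else c i); split.
  { exists i0; split; [lia|]. destruct (Nat.eqb_spec i0 (S n)); [lia|easy]. }
  assert (Hsum : forall l, sumn (S (S n)) (fun i => A l i * (if (i =? S n)%nat then z else c i))
     = sumn (S n) (fun i => A l i * c i) + A l (S n) * z).
  { intros l; change (sumn (S (S n)) ?f) with (sumn (S n) f + f (S n)); f_equal.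
    - apply sumn_ext; intros i Hi. destruct (Nat.eqb_spec i (S n)); [lia|easy].
    - cbv beta; now rewrite Nat.eqb_refl. }
  intros l Hl; rewrite Hsum; unfold z.
  destruct (Nat.eq_dec l p) as [->|Hlp]; [field; easy|].
  assert (Hl' : exists l', (l' < n)%nat /\ skip l' = l).
  { unfold skip; destruct (Nat.lt_ge_cases l p) as [h|h].
    - exists l; split; [lia|]. now destruct (Nat.ltb_spec l p); [|lia].
    - exists (l - 1)%nat; split; [lia|]. destruct (Nat.ltb_spec (l - 1) p); lia. }
  destruct Hl' as (l' & Hl' & <-).
  specialize (Hc l' Hl').
  rewrite (sumn_ext _ _ (fun i => A (skip l') i * c i
     + (- (A (skip l') (S n) / A p (S n))) * (A p i * c i))) in Hc by (intros; ring).
  rewrite sumn_plus, sumn_scal in Hc.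
  replace (sumn (S n) (fun i => A (skip l') i * c i))
    with (A (skip l') (S n) / A p (S n) * sumn (S n) (fun i => A p i * c i)) by lra.
  field; easy.
- exists (fun i => if (i =? S n)%nat then 1 else 0); split.
  { exists (S n); rewrite Nat.eqb_refl; split; [lia|lra]. }
  intros l Hl. apply sumn_zero; intros i Hi.
  destruct (Nat.eqb_spec i (S n)) as [->|]; [|ring].
  destruct (Req_dec (A l (S n)) 0) as [->|h]; [ring|].
  elim Hno; now exists l.
Qed.

(** * Sums over symmetric windows of integers *)

Fixpoint zsum (N : nat) (g : Z -> R) : R :=
  match N with
  | O => g 0%Z
  | S p => zsum p g + g (Z.of_nat (S p)) + g (- Z.of_nat (S p))%Z
  end.

Lemma zsum_ext (N : nat) (f g : Z -> R) :
  (forall x, (Z.abs x <= Z.of_nat N)%Z -> f x = g x) -> zsum N f = zsum N g.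
Proof.
induction N as [|N IH]; intros H; cbn [zsum]; [apply H; lia|].
rewrite IH by (intros; apply H; lia). rewrite !H by lia; easy.
Qed.

Lemma zsum_plus (N : nat) (f g : Z -> R) :
  zsum N (fun x => f x + g x) = zsum N f + zsum N g.
Proof. induction N as [|N IH]; cbn [zsum]; [ring|rewrite IH; ring]. Qed.

Lemma zsum_scal (N : nat) (a : R) (f : Z -> R) :
  zsum N (fun x => a * f x) = a * zsum N f.
Proof. induction N as [|N IH]; cbn [zsum]; [ring|rewrite IH; ring]. Qed.

Lemma zsum_minus (N : nat) (f g : Z -> R) :
  zsum N (fun x => f x - g x) = zsum N f - zsum N g.
Proof. induction N as [|N IH]; cbn [zsum]; [ring|rewrite IH; ring]. Qed.

Lemma zsum_le (N : nat) (f g : Z -> R) :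
  (forall x, (Z.abs x <= Z.of_nat N)%Z -> f x <= g x) -> zsum N f <= zsum N g.
Proof.
induction N as [|N IH]; intros H; cbn [zsum]; [apply H; lia|].
repeat apply Rplus_le_compat; [apply IH; intros| |]; apply H; lia.
Qed.

Lemma zsum_zero (N : nat) (f : Z -> R) :
  (forall x, (Z.abs x <= Z.of_nat N)%Z -> f x = 0) -> zsum N f = 0.
Proof.
intros H; rewrite (zsum_ext N f (fun x => 0 * f x)), zsum_scal; [ring|].
intros; rewrite H by easy; ring.
Qed.

Lemma zsum_ge0 (N : nat) (f : Z -> R) :
  (forall x, (Z.abs x <= Z.of_nat N)%Z -> 0 <= f x) -> 0 <= zsum N f.
Proof.
intros H; rewrite <- (zsum_zero N (fun _ => 0)) by easy; now apply zsum_le.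
Qed.

Lemma zsum_window_le (M N : nat) (f : Z -> R) :
  (M <= N)%nat -> (forall x, 0 <= f x) -> zsum M f <= zsum N f.
Proof.
intros HMN H; induction HMN as [|N HMN IH]; [lra|cbn [zsum]].
pose proof (H (Z.of_nat (S N))); pose proof (H (- Z.of_nat (S N))%Z); lra.
Qed.

Lemma zsum_term_le (N : nat) (f : Z -> R) (y : Z) :
  (Z.abs y <= Z.of_nat N)%Z -> (forall x, 0 <= f x) -> f y <= zsum N f.
Proof.
intros Hy H; induction N as [|N IH].
- replace y with 0%Z by lia; cbn [zsum]; lra.
- cbn [zsum].
  pose proof (H (Z.of_nat (S N))) as H1; pose proof (H (- Z.of_nat (S N))%Z) as H2.
  assert (H3 : 0 <= zsum N f) by now apply zsum_ge0.
  destruct (Z.eq_dec y (Z.of_nat (S N))) as [->|]; [lra|].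
  destruct (Z.eq_dec y (- Z.of_nat (S N))) as [->|]; [lra|].
  assert (f y <= zsum N f) by (apply IH; lia); lra.
Qed.

Lemma zsum_term_eq0 (N : nat) (f : Z -> R) (y : Z) :
  (Z.abs y <= Z.of_nat N)%Z -> (forall x, 0 <= f x) -> zsum N f = 0 -> f y = 0.
Proof. intros Hy H H0; pose proof (zsum_term_le N f y Hy H); specialize (H y); lra. Qed.

Lemma zsum_support (M N : nat) (f : Z -> R) :
  (M <= N)%nat -> (forall x, (Z.of_nat M < Z.abs x)%Z -> f x = 0) ->
  zsum N f = zsum M f.
Proof.
intros HMN H; induction HMN as [|N HMN IH]; [easy|cbn [zsum]].
rewrite IH, !H by lia; ring.
Qed.

Lemma zsum_telescope (N : nat) (p : Z -> R) :
  zsum N (fun x => p (x + 1)%Z - p x) = p (Z.of_nat N + 1)%Z - p (- Z.of_nat N)%Z.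
Proof.
induction N as [|N IH]; [easy|].
cbn [zsum]; rewrite IH.
replace (Z.of_nat N + 1)%Z with (Z.of_nat (S N)) by lia.
replace (- Z.of_nat (S N) + 1)%Z with (- Z.of_nat N)%Z by lia; ring.
Qed.

Lemma zsum_sumn (N n : nat) (f : nat -> Z -> R) :
  zsum N (fun x => sumn n (fun i => f i x)) = sumn n (fun i => zsum N (f i)).
Proof.
induction n as [|n IH]; simpl; [now apply zsum_zero|].
now rewrite zsum_plus, IH.
Qed.

Lemma zsum_window_diff (M N : nat) (f h : Z -> R) :
  (M <= N)%nat ->
  (forall x, (Z.of_nat M < Z.abs x)%Z -> Rabs (f x) <= h x) ->
  Rabs (zsum N f - zsum M f) <= zsum N h - zsum M h.
Proof.
intros HMN H; induction HMN as [|N HMN IH].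
- rewrite !Rminus_diag, Rabs_R0; lra.
- cbn [zsum].
  assert (H1 := H (Z.of_nat (S N)) ltac:(lia)); assert (H2 := H (- Z.of_nat (S N))%Z ltac:(lia)).
  apply Rabs_le_between in IH, H1, H2; apply Rabs_le_between; lra.
Qed.

Lemma zsum_as_sumn (j : nat) (g : Z -> R) :
  zsum j g = sumn (S (2 * j)) (fun m => g (Z.of_nat m - Z.of_nat j)%Z).
Proof.
induction j as [|j IH]; [simpl; ring|].
replace (2 * S j)%nat with (S (S (2 * j))) by lia.
change (sumn (S (S (S (2 * j)))) ?f) with (sumn (S (S (2 * j))) f + f (S (S (2 * j)))).
rewrite sumn_head. cbn [zsum]; rewrite IH.
rewrite (sumn_ext _ (fun m => g (Z.of_nat (S m) - Z.of_nat (S j))%Z)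
  (fun m => g (Z.of_nat m - Z.of_nat j)%Z)) by (intros; f_equal; lia).
replace (Z.of_nat (S (S (2 * j))) - Z.of_nat (S j))%Z with (Z.of_nat (S j)) by lia.
replace (Z.of_nat 0 - Z.of_nat (S j))%Z with (- Z.of_nat (S j))%Z by lia.
ring.
Qed.

(** * The Krawtchouk matrix *)

(* On two bosonic modes with N quanta in total and m quanta in the first one,
   [klower] is a_1 - a_2, which lowers N by one, and [kraise] is its adjoint. *)
Definition klower (N : nat) (f : nat -> R) (m : nat) : R :=
  sqrt (INR m + 1) * f (S m) - sqrt (INR N - INR m) * f m.

Definition kraise (N : nat) (g : nat -> R) (m : nat) : R :=
  sqrt (INR m) * g (m - 1)%nat - sqrt (INR N - INR m) * g m.

(** Values of g outside 0, ..., N - 1 carry a zero coefficient: [sqrt (INR m)] at m = 0, which also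
    disarms the truncated m - 1, and [sqrt (INR N - INR m)] at m = N. *)
Lemma kraise_ext (N : nat) (g h : nat -> R) (m : nat) :
  (forall i, (i < N)%nat -> g i = h i) -> (m <= N)%nat ->
  kraise N g m = kraise N h m.
Proof.
intros H Hm; unfold kraise.
destruct m as [|m].
- simpl INR; rewrite sqrt_0, Rminus_0_r.
  destruct N as [|N]; [simpl; rewrite sqrt_0; ring|rewrite (H O) by lia; ring].
- rewrite (H (S m - 1)%nat) by lia.
  destruct (Nat.eq_dec (S m) N) as [<-|]; [rewrite Rminus_diag, sqrt_0; ring|].
  rewrite (H (S m)) by lia; ring.
Qed.

Lemma kraise_scal (N : nat) (a : R) (g : nat -> R) (m : nat) :
  kraise N (fun i => a * g i) m = a * kraise N g m.
Proof. unfold kraise; ring. Qed.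

Lemma klower_adjoint (N : nat) (f g : nat -> R) :
  sumn N (fun m => klower N f m * g m) = sumn (S N) (fun m => f m * kraise N g m).
Proof.
unfold klower, kraise.
rewrite (sumn_ext (S N) _ (fun m => f m * (sqrt (INR m) * g (m - 1)%nat)
   + - (sqrt (INR N - INR m) * f m * g m))) by (intros; ring).
rewrite sumn_plus, sumn_head.
change (sumn (S N) ?h) with (sumn N h + h N); cbv beta.
simpl (INR 0); rewrite sqrt_0, Rminus_diag, sqrt_0.
rewrite Rmult_0_l, !Rmult_0_r, !Rmult_0_l, Ropp_0, Rplus_0_l, Rplus_0_r, <- sumn_plus.
apply sumn_ext; intros i Hi.
replace (S i - 1)%nat with i by lia. rewrite S_INR; ring.
Qed.

(** The commutation relation [b, b^*] = 2: each mode contributes 1 and the cross terms cancel. On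
    the sector of N quanta, b b^* passes through N + 1 quanta and b^* b through N - 1, whence the
    two indices. *)
Lemma klower_kraise (N : nat) (g : nat -> R) (m : nat) :
  (m <= N)%nat ->
  klower (S N) (kraise (S N) g) m = kraise N (klower N g) m + 2 * g m.
Proof.
intros Hm; unfold klower, kraise.
replace (S m - 1)%nat with m by lia.
rewrite !S_INR.
replace (INR N + 1 - (INR m + 1)) with (INR N - INR m) by ring.
apply le_INR in Hm.
assert (h1 := sqrt_sqrt (INR m + 1) ltac:(pose proof (pos_INR m); lra)).
assert (h2 := sqrt_sqrt (INR N + 1 - INR m) ltac:(lra)).
assert (h3 := sqrt_sqrt (INR N - INR m) ltac:(lra)).
assert (h4 := sqrt_sqrt (INR m) ltac:(apply pos_INR)).
destruct m as [|m].
- simpl INR in *; rewrite sqrt_0.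
  replace (INR N + 1 - 0) with (INR N + 1) in * by ring.
  replace (INR N - 0) with (INR N) in * by ring.
  transitivity (sqrt (0 + 1) * sqrt (0 + 1) * g O
    + sqrt (INR N + 1) * sqrt (INR N + 1) * g O
    - sqrt (INR N) * sqrt (0 + 1) * g 1%nat); [ring|].
  transitivity (- (sqrt (INR N) * sqrt (0 + 1) * g 1%nat)
    + sqrt (INR N) * sqrt (INR N) * g O + 2 * g O); [|ring].
  rewrite h1, h2, h3; ring.
- replace (S m - 1)%nat with m by lia. rewrite S_INR in *.
  replace (INR N - INR m) with (INR N + 1 - (INR m + 1)) by ring.
  set (a := sqrt (INR m + 1 + 1)) in *. set (b := sqrt (INR N + 1 - (INR m + 1))) in *.
  set (c := sqrt (INR N - (INR m + 1))) in *. set (d := sqrt (INR m + 1)) in *.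
  transitivity (a * a * g (S m) - a * c * g (S (S m)) - b * d * g m + b * b * g (S m)); [ring|].
  transitivity (d * d * g (S m) - d * b * g m - c * a * g (S (S m)) + c * c * g (S m)
     + 2 * g (S m)); [|ring].
  rewrite h1, h2, h3, h4; ring.
Qed.

(** For m <= N this is the square root of the binomial coefficient of N over m; the recursion is the
    equation b f = 0 solved upwards from f 0 = 1. *)
Fixpoint kground (N m : nat) : R :=
  match m with
  | O => 1
  | S p => sqrt (INR N - INR p) / sqrt (INR p + 1) * kground N p
  end.

Lemma klower_kground (N m : nat) : klower N (kground N) m = 0.
Proof.
unfold klower; cbn [kground].
assert (0 < sqrt (INR m + 1)) by (apply sqrt_lt_R0; pose proof (pos_INR m); lra).
field; lra.
Qed.

Lemma kground_pos (N m : nat) : (m <= N)%nat -> 0 < kground N m.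
Proof.
induction m as [|m IH]; intros Hm; cbn [kground]; [lra|].
assert (h := lt_INR m N ltac:(lia)).
assert (0 < sqrt (INR m + 1)) by (apply sqrt_lt_R0; pose proof (pos_INR m); lra).
assert (0 < sqrt (INR N - INR m)) by (apply sqrt_lt_R0; lra).
apply Rmult_lt_0_compat; [apply Rdiv_lt_0_compat; lra|apply IH; lia].
Qed.

(** The i-fold power of b^* applied to the kernel vector with N - i quanta, so that all these
    vectors share the sector of N quanta. For i > N the recursion stops at [kground 0], a
    default. *)
Fixpoint kvec (i N : nat) : nat -> R :=
  match i, N with
  | S i', S N' => kraise (S N') (kvec i' N')
  | _, _ => kground N
  end.

(** By the commutation relation b^* b b^* = b^* (b^* b + 2), so each application of b^* raises the
    eigenvalue by 2. *)
Lemma kvec_eigen (i N m : nat) : (i <= N)%nat -> (m <= N)%nat ->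
  kraise N (klower N (kvec i N)) m = 2 * INR i * kvec i N m.
Proof.
revert N m; induction i as [|i IH]; intros N m Hi Hm.
- simpl kvec; replace (match N with O => _ | S _ => _ end) with (kground N) by now destruct N.
  unfold kraise; rewrite !klower_kground; simpl; ring.
- destruct N as [|N]; [lia|]. cbn [kvec].
  rewrite (kraise_ext _ _ (fun l => 2 * INR (S i) * kvec i N l)); [|intros l Hl|easy].
  + apply kraise_scal.
  + rewrite klower_kraise, IH by lia. rewrite S_INR; ring.
Qed.

(** If b^* b g = 2 i g then |b^* g|^2 = <b b^* g, g> = 2 (i + 1) |g|^2, so raising never
    annihilates. *)
Lemma kvec_norm_pos (i N : nat) : (i <= N)%nat ->
  0 < sumn (S N) (fun m => kvec i N m * kvec i N m).
Proof.
revert N; induction i as [|i IH]; intros N Hi.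
- apply Rlt_le_trans with (kvec 0 N 0 * kvec 0 N 0); [destruct N; simpl; lra|].
  apply (sumn_term_le _ 0 (fun m => kvec 0 N m * kvec 0 N m)); [lia|intros; nra].
- destruct N as [|N]; [lia|]. cbn [kvec].
  rewrite <- klower_adjoint.
  rewrite (sumn_ext _ _ (fun m => 2 * INR (S i) * (kvec i N m * kvec i N m))).
  + rewrite sumn_scal; apply Rmult_lt_0_compat; [|apply IH; lia].
    assert (0 < INR (S i)) by (apply lt_0_INR; lia); lra.
  + intros m Hm; rewrite klower_kraise, kvec_eigen by lia. rewrite S_INR; ring.
Qed.

Lemma kvec_orth (i l N : nat) : (i <= N)%nat -> (l <= N)%nat -> i <> l ->
  sumn (S N) (fun m => kvec i N m * kvec l N m) = 0.
Proof.
intros Hi Hl Hil.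
assert (H : forall a b, (a <= N)%nat -> (b <= N)%nat ->
   sumn N (fun m => klower N (kvec a N) m * klower N (kvec b N) m)
   = 2 * INR b * sumn (S N) (fun m => kvec a N m * kvec b N m)).
{ intros a b Ha Hb; rewrite klower_adjoint, <- sumn_scal.
  apply sumn_ext; intros m Hm; rewrite kvec_eigen by lia; ring. }
assert (H1 := H i l Hi Hl); assert (H2 := H l i Hl Hi).
rewrite (sumn_ext (S N) (fun m => kvec l N m * kvec i N m) (fun m => kvec i N m * kvec l N m)) in H2
  by (intros; ring).
rewrite (sumn_ext N (fun m => klower N (kvec l N) m * klower N (kvec i N) m)
  (fun m => klower N (kvec i N) m * klower N (kvec l N) m)) in H2 by (intros; ring).
assert (INR i <> INR l) by now apply not_INR.
assert (H3 : (INR i - INR l) * sumn (S N) (fun m => kvec i N m * kvec l N m) = 0) by lra.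
apply Rmult_integral in H3; destruct H3; lra.
Qed.

Lemma kvec_comb_norm (n N : nat) (c w : nat -> R) : (n <= N)%nat ->
  sumn (S N) (fun m => sumn (S n) (fun i => c i * w i * kvec i N m)
                       * sumn (S n) (fun i => c i * kvec i N m))
  = sumn (S n) (fun i => w i * (c i ^ 2 * sumn (S N) (fun m => kvec i N m * kvec i N m))).
Proof.
intros Hn.
rewrite (sumn_ext (S N) _ (fun m => sumn (S n) (fun i => sumn (S n) (fun l =>
   c i * w i * kvec i N m * (c l * kvec l N m))))) by (intros; apply sumn_mul).
rewrite sumn_exchange; apply sumn_ext; intros i Hi.
rewrite sumn_exchange.
rewrite (sumn_single _ i); [|easy|].
- rewrite <- 2!sumn_scal; apply sumn_ext; intros; ring.
- intros l Hl Hli.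
  rewrite (sumn_ext _ _ (fun m => c i * w i * c l * (kvec i N m * kvec l N m))) by (intros; ring).
  rewrite sumn_scal, kvec_orth by lia; ring.
Qed.

Lemma klower_comb (n N : nat) (c : nat -> R) : (n <= N)%nat ->
  sumn N (fun m => klower N (fun p => sumn (S n) (fun i => c i * kvec i N p)) m ^ 2)
  <= 2 * INR n * sumn (S N) (fun m => sumn (S n) (fun i => c i * kvec i N m) ^ 2).
Proof.
intros Hn. set (u := fun p => sumn (S n) (fun i => c i * kvec i N p)).
rewrite (sumn_ext N _ (fun m => klower N u m * klower N u m)) by (intros; ring).
rewrite klower_adjoint.
rewrite (sumn_ext (S N) (fun m => sumn (S n) (fun i => c i * kvec i N m) ^ 2)
  (fun m => sumn (S n) (fun i => c i * 1 * kvec i N m)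
   * sumn (S n) (fun i => c i * kvec i N m))).
2:{ intros m _. rewrite (sumn_ext (S n) (fun i => c i * 1 * kvec i N m)
      (fun i => c i * kvec i N m)) by (intros; ring). ring. }
rewrite (sumn_ext (S N) _ (fun m => sumn (S n) (fun i => c i * (2 * INR i) * kvec i N m)
   * sumn (S n) (fun i => c i * kvec i N m))).
2:{ intros m Hm. rewrite Rmult_comm; fold (u m); f_equal.
    assert (HL : forall p q, klower N (fun x => sumn q (fun i => c i * kvec i N x)) p
       = sumn q (fun i => c i * klower N (kvec i N) p)).
    { intros p q; unfold klower; induction q as [|q IH]; simpl; [ring|].
      rewrite <- IH; ring. }
    assert (HR : forall q, kraise N (fun x => sumn q (fun i => c i * klower N (kvec i N) x)) m
       = sumn q (fun i => c i * kraise N (klower N (kvec i N)) m)).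
    { intros q; unfold kraise; induction q as [|q IH]; simpl; [ring|].
      rewrite <- IH; ring. }
    rewrite (kraise_ext _ _ _ _ (fun p _ => HL p (S n))) by lia.
    rewrite HR; apply sumn_ext; intros i Hi; rewrite kvec_eigen by lia; ring. }
rewrite !kvec_comb_norm by easy. rewrite <- sumn_scal.
apply sumn_le; intros i Hi.
assert (Hin := le_INR i n ltac:(lia)).
assert (0 <= c i ^ 2 * sumn (S N) (fun m => kvec i N m * kvec i N m)).
{ apply Rmult_le_pos; [apply pow2_ge_0|apply Rlt_le, kvec_norm_pos; lia]. }
nra.
Qed.

Fixpoint kraise_preimage (N : nat) (f : nat -> R) (m : nat) : R :=
  match m with
  | O => - f O / sqrt (INR N)
  | S p => (sqrt (INR (S p)) * kraise_preimage N f p - f (S p)) / sqrt (INR N - INR (S p))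
  end.

(** The range of b^* is the orthogonal complement of the kernel of b. Rows m = 0, ..., N determine g
    by forward substitution; the last row then holds because f and [kraise (S N) g] are both
    orthogonal to [kground (S N)], whose last entry is positive. *)
Lemma kraise_surj (N : nat) (f : nat -> R) :
  sumn (S (S N)) (fun m => f m * kground (S N) m) = 0 ->
  exists g, forall m, (m <= S N)%nat -> f m = kraise (S N) g m.
Proof.
intros H; set (g := kraise_preimage (S N) f); exists g.
assert (Hlow : forall m, (m <= N)%nat -> f m = kraise (S N) g m).
{ intros m Hm. unfold kraise, g.
  assert (h := lt_INR m (S N) ltac:(lia)).
  assert (0 < sqrt (INR (S N) - INR m)) by (apply sqrt_lt_R0; lra).
  destruct m as [|m].
  - simpl (INR 0) in *; rewrite sqrt_0; cbn [kraise_preimage].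
    rewrite Rminus_0_r in *; field; lra.
  - replace (S m - 1)%nat with m by lia. cbn [kraise_preimage]; field; lra. }
intros m Hm. destruct (Nat.eq_dec m (S N)) as [->|]; [|apply Hlow; lia].
assert (H2 : sumn (S (S N)) (fun m => kground (S N) m * kraise (S N) g m) = 0).
{ rewrite <- klower_adjoint; apply sumn_zero; intros; rewrite klower_kground; ring. }
change (sumn (S (S N)) ?h) with (sumn (S N) h + h (S N)) in H, H2; cbv beta in H, H2.
rewrite (sumn_ext (S N) (fun m => f m * kground (S N) m)
  (fun m => kground (S N) m * kraise (S N) g m)) in H
  by (intros; rewrite <- Hlow by lia; ring).
assert (h := kground_pos (S N) (S N) (Nat.le_refl _)).
apply (Rmult_eq_reg_l (kground (S N) (S N))); lra.
Qed.

(** Induction through b^* takes the place of completeness of the [kvec] family. Orthogonality to the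
    kernel gives f = b^* g, and the remaining conditions pass to g because <b^* g, b^* v_i> = 2 (i +
    1) <g, v_i>. On g the operator M = b b^* = b^* b + 2 has form at least 2 (n + 1), while |f|^2 =
    <M g, g> and |b f|^2 = |M g|^2. *)
Lemma klower_bound (n N : nat) (f : nat -> R) : (n <= N)%nat ->
  (forall i, (i < n)%nat -> sumn (S N) (fun m => f m * kvec i N m) = 0) ->
  2 * INR n * sumn (S N) (fun m => f m ^ 2) <= sumn N (fun m => klower N f m ^ 2).
Proof.
revert N f; induction n as [|n IH]; intros N f Hn Horth.
{ simpl (INR 0); rewrite Rmult_0_r, Rmult_0_l; apply sumn_ge0; intros; apply pow2_ge_0. }
destruct N as [|N]; [lia|].
destruct (kraise_surj N f) as [g Hg].
{ apply (Horth O); lia. }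
set (M := fun m => klower (S N) (kraise (S N) g) m).
assert (HM : forall m, (m < S N)%nat -> klower (S N) f m = M m).
{ intros m Hm; unfold M, klower at 1 2. rewrite !Hg by lia; easy. }
assert (Hgorth : forall i, (i < n)%nat -> sumn (S N) (fun m => g m * kvec i N m) = 0).
{ intros i Hi. assert (H := Horth (S i) ltac:(lia)); cbn [kvec] in H.
  rewrite <- klower_adjoint in H.
  rewrite (sumn_ext _ _ (fun m => M m * kvec i N m)) in H by (intros; rewrite HM by lia; easy).
  rewrite (sumn_ext _ _ (fun m => kvec i N m * M m)) in H by (intros; ring).
  unfold M in H.
  rewrite (sumn_ext _ _ (fun m => kvec i N m * kraise N (klower N g) m + 2 * (g m * kvec i N m))) in H
    by (intros; rewrite klower_kraise by lia; ring).
  rewrite sumn_plus, sumn_scal, <- klower_adjoint in H.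
  rewrite (sumn_ext N _ (fun m => klower N g m * klower N (kvec i N) m)) in H by (intros; ring).
  rewrite klower_adjoint in H.
  rewrite (sumn_ext (S N) _ (fun m => 2 * INR i * (g m * kvec i N m))) in H
    by (intros; rewrite kvec_eigen by lia; ring).
  rewrite sumn_scal in H. pose proof (pos_INR i). nra. }
specialize (IH N g ltac:(lia) Hgorth).
set (G := sumn (S N) (fun m => g m ^ 2)) in *.
assert (HMg : sumn (S N) (fun m => M m * g m) = sumn N (fun m => klower N g m ^ 2) + 2 * G).
{ unfold G; rewrite (sumn_ext N _ (fun m => klower N g m * klower N g m)) by (intros; ring).
  rewrite klower_adjoint, <- sumn_scal, <- sumn_plus; apply sumn_ext; intros m Hm.
  unfold M; rewrite klower_kraise by lia; ring. }
assert (Hff : sumn (S (S N)) (fun m => f m ^ 2) = sumn (S N) (fun m => M m * g m)).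
{ unfold M; rewrite klower_adjoint; apply sumn_ext; intros m Hm; rewrite Hg by lia; ring. }
rewrite (sumn_ext (S N) (fun m => klower _ f m ^ 2) (fun m => M m ^ 2))
  by (intros; rewrite HM by lia; easy).
rewrite Hff; rewrite HMg in *.
set (a := 2 * INR (S n)). set (X := sumn N (fun m => klower N g m ^ 2) + 2 * G) in *.
assert (HX : a * G <= X) by (unfold a, X; rewrite S_INR; lra).
assert (0 < a) by (unfold a; pose proof (pos_INR n); rewrite S_INR; lra).
(* |M g|^2 - a <M g, g> = |(M - a) g|^2 + a (<M g, g> - a |g|^2) *)
assert (HS : 0 <= sumn (S N) (fun m => (M m - a * g m) ^ 2))
  by (apply sumn_ge0; intros; apply pow2_ge_0).
rewrite (sumn_ext _ _ (fun m => M m ^ 2 + (- (2 * a) * (M m * g m) + a ^ 2 * g m ^ 2))) in HS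
  by (intros; ring).
rewrite 2!sumn_plus, 2!sumn_scal, HMg in HS; fold G in HS.
assert (0 <= a * (X - a * G)) by (apply Rmult_le_pos; lra).
lra.
Qed.

(** * The Krawtchouk form on the integers *)

Definition supp (N : nat) (f : Z -> R) : Prop :=
  forall x, (Z.of_nat N < Z.abs x)%Z -> f x = 0.

Lemma supp_le (M N : nat) (f : Z -> R) : (M <= N)%nat -> supp M f -> supp N f.
Proof. intros H Hf x Hx; apply Hf; lia. Qed.

Lemma supp_sumn (N n : nat) (f : nat -> Z -> R) :
  (forall i, (i < n)%nat -> supp N (f i)) -> supp N (fun x => sumn n (fun i => f i x)).
Proof. intros H x Hx; apply sumn_zero; intros i Hi; now apply H. Qed.

Lemma zsum_shift (M N : nat) (h : Z -> R) :
  supp M h -> (M < N)%nat -> zsum N (fun x => h (x + 1)%Z) = zsum N h.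
Proof.
intros H HMN; assert (T := zsum_telescope N h).
rewrite zsum_minus, !H in T by lia; lra.
Qed.

(* Bonds join x and x + 1; [x + 1/2] is the midpoint and [j + 1/2] the edge of the spin-j lattice. *)
Definition bond (j : nat) (x : Z) : R :=
  sqrt (1 - ((IZR x + / 2) / (INR j + / 2)) ^ 2).

(** Expanded, this is v(x)^2 + v(x+1)^2 - 2 [bond j x] v(x) v(x+1). The split isolates a weighted
    kinetic part and, as 1 - [bond j x] is close to half the square of (x + 1/2) / (j + 1/2), a
    harmonic potential. *)
Definition kform (j : nat) (v : Z -> R) (x : Z) : R :=
  bond j x * (v (x + 1)%Z - v x) ^ 2 + (1 - bond j x) * (v x ^ 2 + v (x + 1)%Z ^ 2).

Definition zlower (j : nat) (v : Z -> R) (x : Z) : R :=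
  sqrt (INR j + IZR x + 1) * v (x + 1)%Z - sqrt (INR j - IZR x) * v x.

(** The radicands multiply to (j + 1/2)^2 - (x + 1/2)^2, which yields [bond]. Written as (j + 1/2)
    plus or minus (x + 1/2), they leave the diagonal rest (x + 1/2) (v(x+1)^2 - v(x)^2), which is a
    telescoping difference minus v(x)^2. *)
Lemma zlower_sq (j : nat) (v : Z -> R) (x : Z) :
  supp j v -> (- Z.of_nat j - 1 <= x)%Z ->
  zlower j v x ^ 2 = (INR j + / 2) * kform j v x
    + (((IZR (x + 1) - / 2) * v (x + 1)%Z ^ 2 - (IZR x - / 2) * v x ^ 2) - v x ^ 2).
Proof.
intros Hv Hx.
destruct (Z_lt_le_dec (Z.of_nat j) x) as [h|h].
{ unfold zlower, kform; rewrite !(Hv x), !(Hv (x + 1)%Z) by lia; ring. }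
assert (h1 : IZR x <= INR j) by (rewrite INR_IZR_INZ; now apply IZR_le).
assert (h2 : - INR j - 1 <= IZR x).
{ rewrite INR_IZR_INZ, <- opp_IZR, <- minus_IZR; now apply IZR_le. }
assert (hj := pos_INR j).
assert (HA := sqrt_sqrt (INR j + IZR x + 1) ltac:(lra)).
assert (HB := sqrt_sqrt (INR j - IZR x) ltac:(lra)).
assert (HAB : sqrt (INR j + IZR x + 1) * sqrt (INR j - IZR x) = (INR j + / 2) * bond j x).
{ rewrite <- sqrt_mult by lra. unfold bond.
  rewrite <- (sqrt_Rsqr (INR j + / 2)) at 1 by lra.
  rewrite <- sqrt_mult_alt by apply Rle_0_sqr. unfold Rsqr; f_equal; field; lra. }
unfold zlower, kform; rewrite plus_IZR.
set (A := sqrt (INR j + IZR x + 1)) in *; set (B := sqrt (INR j - IZR x)) in *.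
set (v1 := v (x + 1)%Z); set (v0 := v x).
transitivity (A * A * v1 ^ 2 + B * B * v0 ^ 2 - 2 * (A * B) * v0 * v1); [ring|].
rewrite HA, HB, HAB; field.
Qed.

Lemma zlower_norm (j : nat) (v : Z -> R) : supp j v ->
  zsum j (fun x => zlower j v x ^ 2)
  = (INR j + / 2) * zsum (S j) (kform j v) - zsum j (fun x => v x ^ 2).
Proof.
intros Hv.
(* At x = -j - 1 the coefficient of v(-j) is [sqrt 0], so the additional bond in the window S j
   contributes nothing. *)
assert (E1 : zsum (S j) (fun x => zlower j v x ^ 2) = zsum j (fun x => zlower j v x ^ 2)).
{ cbn [zsum]. unfold zlower. rewrite !(Hv (Z.of_nat (S j))), !(Hv (Z.of_nat (S j) + 1)%Z),
    !(Hv (- Z.of_nat (S j))%Z) by lia.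
  replace (INR j + IZR (- Z.of_nat (S j)) + 1) with 0.
  - rewrite sqrt_0; ring.
  - rewrite opp_IZR, <- INR_IZR_INZ, S_INR; ring. }
rewrite <- E1, (zsum_ext (S j) _ (fun x => (INR j + / 2) * kform j v x
    + (((IZR (x + 1) - / 2) * v (x + 1)%Z ^ 2 - (IZR x - / 2) * v x ^ 2) - v x ^ 2)))
  by (intros; apply zlower_sq; [easy|lia]).
rewrite zsum_plus, zsum_scal, zsum_minus.
rewrite (zsum_telescope (S j) (fun x => (IZR x - / 2) * v x ^ 2)).
rewrite (zsum_support j (S j) (fun x => v x ^ 2)); [|lia|intros; rewrite Hv by lia; ring].
rewrite !Hv by lia; ring.
Qed.

(** Each site collects half of (x + 1/2)^2 from the bond on its right and half of (x - 1/2)^2 from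
    the one on its left, in total x^2 + 1/4. *)
Lemma zsum_bond_potential (j N : nat) (v : Z -> R) : supp j v -> (j < N)%nat ->
  zsum N (fun x => (IZR x + / 2) ^ 2 * ((v x ^ 2 + v (x + 1)%Z ^ 2) / 2))
  = zsum N (fun x => (IZR x ^ 2 + / 4) * v x ^ 2).
Proof.
intros Hv HN.
rewrite (zsum_ext N _ (fun x => / 2 * ((IZR x + / 2) ^ 2 * v x ^ 2)
   + / 2 * ((IZR (x + 1) - / 2) ^ 2 * v (x + 1)%Z ^ 2)))
  by (intros; rewrite plus_IZR; field).
rewrite zsum_plus, 2!zsum_scal.
rewrite (zsum_shift j N (fun x => (IZR x - / 2) ^ 2 * v x ^ 2)); [|intros x Hx; rewrite Hv by lia; ring|easy].
rewrite <- 2!zsum_scal, <- zsum_plus; apply zsum_ext; intros; field.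
Qed.

(** With 2j quanta in all, m in the first mode, the position x = m - j is half the difference of the
    two occupation numbers. *)
Definition zkvec (j i : nat) (x : Z) : R :=
  if (Z.abs x <=? Z.of_nat j)%Z then kvec i (2 * j) (Z.to_nat (x + Z.of_nat j)) else 0.

Lemma zkvec_supp (j i : nat) : supp j (zkvec j i).
Proof. intros x Hx; unfold zkvec; destruct (Z.leb_spec (Z.abs x) (Z.of_nat j)); [lia|easy]. Qed.

Lemma zkvec_kvec (j i m : nat) : (m < S (2 * j))%nat ->
  zkvec j i (Z.of_nat m - Z.of_nat j) = kvec i (2 * j) m.
Proof.
intros Hm; unfold zkvec; destruct (Z.leb_spec (Z.abs (Z.of_nat m - Z.of_nat j)) (Z.of_nat j)); [|lia].
f_equal; lia.
Qed.

Lemma zlower_klower (j : nat) (v : Z -> R) : supp j v ->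
  zsum j (fun x => zlower j v x ^ 2)
  = sumn (2 * j) (fun m => klower (2 * j) (fun p => v (Z.of_nat p - Z.of_nat j)%Z) m ^ 2).
Proof.
intros Hv; rewrite zsum_as_sumn.
change (sumn (S (2 * j)) ?h) with (sumn (2 * j) h + h (2 * j)%nat); cbv beta.
assert (Hl : forall m, zlower j v (Z.of_nat m - Z.of_nat j)
  = klower (2 * j) (fun p => v (Z.of_nat p - Z.of_nat j)%Z) m).
{ intros m; unfold zlower, klower. rewrite minus_IZR, <- !INR_IZR_INZ, mult_INR.
  replace (Z.of_nat m - Z.of_nat j + 1)%Z with (Z.of_nat (S m) - Z.of_nat j)%Z by lia.
  f_equal; do 2 f_equal; simpl; ring. }
rewrite Hl; unfold klower at 1.
rewrite (Hv (Z.of_nat (S (2 * j)) - Z.of_nat j)%Z) by lia.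
rewrite Rminus_diag, sqrt_0.
rewrite (sumn_ext _ _ (fun m => klower (2 * j) (fun p => v (Z.of_nat p - Z.of_nat j)%Z) m ^ 2))
  by (intros; now rewrite Hl). ring.
Qed.

Lemma kform_lower (n j : nat) (v : Z -> R) : (n <= 2 * j)%nat -> supp j v ->
  (forall i, (i < n)%nat -> zsum j (fun x => v x * zkvec j i x) = 0) ->
  (2 * INR n + 1) * zsum j (fun x => v x ^ 2) <= (INR j + / 2) * zsum (S j) (kform j v).
Proof.
intros Hn Hv Horth.
assert (H := klower_bound n (2 * j) (fun p => v (Z.of_nat p - Z.of_nat j)%Z) Hn).
rewrite <- zlower_klower, zlower_norm in H by easy.
rewrite <- (zsum_as_sumn j (fun x => v x ^ 2)) in H.
rewrite Rmult_plus_distr_r, Rmult_1_l.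
enough (2 * INR n * zsum j (fun x => v x ^ 2)
  <= (INR j + / 2) * zsum (S j) (kform j v) - zsum j (fun x => v x ^ 2)) by lra.
apply H; intros i Hi; rewrite <- (Horth i Hi), zsum_as_sumn.
apply sumn_ext; intros m Hm; now rewrite zkvec_kvec.
Qed.

Lemma kform_upper (n j : nat) (c : nat -> R) : (n <= 2 * j)%nat ->
  let u := fun x => sumn (S n) (fun i => c i * zkvec j i x) in
  (INR j + / 2) * zsum (S j) (kform j u) <= (2 * INR n + 1) * zsum j (fun x => u x ^ 2).
Proof.
intros Hn u.
assert (Hu : supp j u).
{ apply supp_sumn; intros i _ x Hx; rewrite zkvec_supp by easy; ring. }
assert (H := klower_comb n (2 * j) c Hn).
assert (E1 : zsum j (fun x => u x ^ 2)
  = sumn (S (2 * j)) (fun m => sumn (S n) (fun i => c i * kvec i (2 * j) m) ^ 2)).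
{ rewrite zsum_as_sumn; apply sumn_ext; intros m Hm; unfold u; f_equal.
  apply sumn_ext; intros; now rewrite zkvec_kvec. }
assert (E2 := zlower_klower j u Hu). rewrite zlower_norm in E2 by easy.
rewrite <- E1 in H.
rewrite (sumn_ext (2 * j) _ (fun m => klower (2 * j)
  (fun p => u (Z.of_nat p - Z.of_nat j)%Z) m ^ 2)) in H; [lra|].
intros m Hm; unfold klower, u; f_equal; f_equal; f_equal;
  apply sumn_ext; intros; now rewrite zkvec_kvec by lia.
Qed.

Lemma zkvec_comb_pos (n j : nat) (c : nat -> R) : (n <= 2 * j)%nat ->
  (exists i, (i <= n)%nat /\ c i <> 0) ->
  0 < zsum j (fun x => sumn (S n) (fun i => c i * zkvec j i x) ^ 2).
Proof.
intros Hn (p & Hp & Hc). rewrite zsum_as_sumn.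
rewrite (sumn_ext _ _ (fun m => sumn (S n) (fun i => c i * 1 * kvec i (2 * j) m)
   * sumn (S n) (fun i => c i * kvec i (2 * j) m))).
2:{ intros m Hm; rewrite <- Rsqr_pow2; unfold Rsqr; f_equal;
    apply sumn_ext; intros; rewrite zkvec_kvec by easy; ring. }
rewrite kvec_comb_norm by easy.
assert (Hpos : forall i, (i <= n)%nat ->
  0 < sumn (S (2 * j)) (fun m => kvec i (2 * j) m * kvec i (2 * j) m))
  by (intros; apply kvec_norm_pos; lia).
eapply Rlt_le_trans; [|apply (sumn_term_le _ p); [lia|]].
- rewrite Rmult_1_l; apply Rmult_lt_0_compat; [now apply pow2_gt_0|now apply Hpos].
- intros i Hi; rewrite Rmult_1_l; apply Rmult_le_pos; [apply pow2_ge_0|].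
  apply Rlt_le, Hpos; lia.
Qed.

(** * Cutoff estimates *)

Lemma Rmax0_lipschitz (a b : R) : (Rmax 0 a - Rmax 0 b) ^ 2 <= (a - b) ^ 2.
Proof.
rewrite <- !Rsqr_pow2; apply Rsqr_le_abs_1.
unfold Rmax; destruct (Rle_dec 0 a), (Rle_dec 0 b); unfold Rabs;
  repeat destruct Rcase_abs; lra.
Qed.

(** A parabolic bump rather than a plateau: 1 - [cutoff L x] is at most (x / L)^2, so the mass
    removed is controlled by the potential energy, and the slope is of order 1 / L. *)
Definition cutoff (L : R) (x : Z) : R := Rmax 0 (1 - (IZR x / L) ^ 2).

Lemma cutoff_range (L : R) (x : Z) : 0 <= cutoff L x <= 1.
Proof.
unfold cutoff; split; [apply Rmax_l|apply Rmax_lub; [lra|]].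
pose proof (pow2_ge_0 (IZR x / L)); lra.
Qed.

Lemma cutoff_neq0 (L : R) (x : Z) : 0 < L -> cutoff L x <> 0 -> IZR x ^ 2 < L ^ 2.
Proof.
intros HL; unfold cutoff, Rmax; destruct Rle_dec as [h|h]; [|easy]; intros h'.
assert (h2 : (IZR x / L) ^ 2 < 1) by lra.
assert (0 < L ^ 2) by now apply pow_lt.
replace (IZR x ^ 2) with ((IZR x / L) ^ 2 * L ^ 2) by (field; lra). nra.
Qed.

Lemma cutoff_loss (L : R) (x : Z) : 0 < L ->
  1 - cutoff L x ^ 2 <= 2 * (IZR x ^ 2 / L ^ 2).
Proof.
intros HL.
replace (IZR x ^ 2 / L ^ 2) with ((IZR x / L) ^ 2) by (field; lra).
unfold cutoff; set (t := (IZR x / L) ^ 2).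
assert (0 <= t) by apply pow2_ge_0.
unfold Rmax; destruct Rle_dec; nra.
Qed.

Lemma cutoff_slope (L : R) (x : Z) : 1 <= L ->
  (cutoff L (x + 1) - cutoff L x) ^ 2 <= 9 / L ^ 2.
Proof.
intros HL.
assert (H0 : 0 <= 9 / L ^ 2) by (apply Rlt_le, Rdiv_lt_0_compat; [lra|apply pow_lt; lra]).
destruct (classic (cutoff L (x + 1) = 0 /\ cutoff L x = 0)) as [[-> ->]|h].
{ now rewrite Rminus_diag, pow_i by lia. }
(* One end of the bond lies within distance L of 0, so |2x + 1| <= 2L + 1 <= 3L; hence the constant
   9. *)
assert (Hx : (2 * IZR x + 1) ^ 2 <= (3 * L) ^ 2).
{ assert (Habs : forall y : Z, IZR y ^ 2 < L ^ 2 -> - L < IZR y < L).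
  { intros y Hy; split; nra. }
  apply not_and_or in h; destruct h as [h|h]; apply cutoff_neq0, Habs in h; try lra.
  - rewrite plus_IZR in h; nra.
  - nra. }
eapply Rle_trans; [apply Rmax0_lipschitz|].
rewrite plus_IZR.
replace (1 - ((IZR x + 1) / L) ^ 2 - (1 - (IZR x / L) ^ 2)) with (- (2 * IZR x + 1) / L ^ 2)
  by (field; lra).
replace ((- (2 * IZR x + 1) / L ^ 2) ^ 2) with ((2 * IZR x + 1) ^ 2 / L ^ 4) by (field; lra).
replace (9 / L ^ 2) with ((3 * L) ^ 2 / L ^ 4) by (field; lra).
apply Rmult_le_compat_r; [|easy]. apply Rlt_le, Rinv_0_lt_compat, pow_lt; lra.
Qed.

(* (a + b)^2 <= (1 + s) a^2 + (1 + 1/s) b^2 with a = chi(x+1) Df(x) and b = f(x) Dchi(x) *)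
Lemma cutoff_diff (s L : R) (f : Z -> R) (x : Z) : 0 < s -> 1 <= L ->
  (cutoff L (x + 1) * f (x + 1)%Z - cutoff L x * f x) ^ 2
  <= (1 + s) * (cutoff L (x + 1) ^ 2 * (f (x + 1)%Z - f x) ^ 2)
     + (1 + / s) * (9 / L ^ 2) * f x ^ 2.
Proof.
intros Hs HL. assert (HD := cutoff_slope L x HL).
set (c1 := cutoff L (x + 1)) in *; set (c0 := cutoff L x) in *.
set (d := f (x + 1)%Z - f x).
replace (c1 * f (x + 1)%Z - c0 * f x) with (c1 * d + f x * (c1 - c0)) by (unfold d; ring).
assert (His : 0 < / s) by now apply Rinv_0_lt_compat.
assert (HF : (c1 - c0) ^ 2 * f x ^ 2 <= 9 / L ^ 2 * f x ^ 2)
  by (apply Rmult_le_compat_r; [apply pow2_ge_0|easy]).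
assert (Hsq : 0 <= / s * (s * (c1 * d) - f x * (c1 - c0)) ^ 2)
  by (apply Rmult_le_pos; [lra|apply pow2_ge_0]).
replace (/ s * (s * (c1 * d) - f x * (c1 - c0)) ^ 2)
  with (s * (c1 ^ 2 * d ^ 2) - 2 * (c1 * d) * (f x * (c1 - c0)) + / s * ((c1 - c0) ^ 2 * f x ^ 2))
  in Hsq by (field; lra).
assert (HF' := Rmult_le_compat_l (1 + / s) _ _ ltac:(lra) HF).
nra.
Qed.

Lemma sqrt_1m_bounds (t : R) : 0 <= t <= 1 ->
  1 - t <= sqrt (1 - t) /\ 1 - t / 2 - t ^ 2 / 2 <= sqrt (1 - t) <= 1 - t / 2.
Proof.
intros Ht; set (r := sqrt (1 - t)).
assert (Hr : r * r = 1 - t) by (apply sqrt_sqrt; lra).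
assert (Hr0 : 0 <= r) by apply sqrt_pos.
repeat split; [nra| |nra].
destruct (Rle_lt_dec (1 - t / 2 - t ^ 2 / 2) 0) as [h|h]; [lra|].
apply Rnot_lt_le; intros h'.
assert (r * r < (1 - t / 2 - t ^ 2 / 2) ^ 2) by nra.
nra.
Qed.


(* The scales: kappa = s^4, cutoff radius s^-5, spin j close to kappa^-2 = s^-8 *)
Definition scaled (s : R) (j : nat) : Prop :=
  0 < s <= / 2 /\ 1 <= s ^ 8 * (INR j + / 2) <= 1 + 2 * s ^ 8.

Lemma pow_le_base (s : R) (m p : nat) : 0 < s <= 1 -> (p <= m)%nat -> s ^ m <= s ^ p.
Proof.
intros Hs H; replace m with (p + (m - p))%nat by lia; rewrite pow_add.
assert (0 < s ^ p) by (apply pow_lt; lra).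
assert (s ^ (m - p) <= 1) by (rewrite <- (pow1 (m - p)); apply pow_incr; lra).
nra.
Qed.

Lemma scaled_radius (s : R) (j : nat) (x : Z) : scaled s j ->
  cutoff (/ s ^ 5) x <> 0 -> (Z.abs x <= Z.of_nat j)%Z.
Proof.
intros [Hs Hj] Hx.
assert (H5 : 0 < s ^ 5) by (apply pow_lt; lra).
apply cutoff_neq0 in Hx; [|now apply Rinv_0_lt_compat].
set (L := / s ^ 5) in *.
assert (HL : L * s ^ 5 = 1) by (unfold L; field; lra).
assert (HL0 : 0 < L) by (unfold L; now apply Rinv_0_lt_compat).
assert (HLx : Rabs (IZR x) < L).
{ rewrite <- !Rsqr_pow2 in Hx; apply Rsqr_lt_abs_0 in Hx; rewrite (Rabs_pos_eq L) in Hx; lra. }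
assert (H3 : s ^ 3 <= / 8).
{ assert (s ^ 3 <= (/ 2) ^ 3) by (apply pow_incr; lra). lra. }
assert (H30 : 0 < s ^ 3) by (apply pow_lt; lra).
assert (Hlj : L <= INR j + / 2 - 1).
{ assert (L * 8 <= INR j + / 2).
  { apply (Rmult_le_reg_l (s ^ 8)); [apply pow_lt; lra|].
    replace (s ^ 8 * (L * 8)) with (8 * s ^ 3 * (L * s ^ 5)) by ring. rewrite HL; lra. }
  assert (1 <= L); [|lra].
  apply (Rmult_le_reg_r (s ^ 5)); [easy|]. rewrite HL.
  assert (s ^ 5 <= s ^ 0) by (apply pow_le_base; [lra|lia]). simpl in *; lra. }
rewrite <- abs_IZR, INR_IZR_INZ in *.
apply Z.lt_le_incl, lt_IZR. lra.
Qed.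

(** A bond touching the support of the cutoff has |x + 1/2| <= 2 s^-5 while j + 1/2 >= s^-8; the
    squared ratio is thus at most 4 s^6, which lies below s for s <= 1/2. *)
Lemma scaled_bond (s : R) (j : nat) (x : Z) : scaled s j ->
  cutoff (/ s ^ 5) x <> 0 \/ cutoff (/ s ^ 5) (x + 1) <> 0 ->
  0 <= ((IZR x + / 2) / (INR j + / 2)) ^ 2 <= s.
Proof.
intros [Hs Hj] Hx; split; [apply pow2_ge_0|].
assert (H5 : 0 < s ^ 5) by (apply pow_lt; lra).
set (L := / s ^ 5) in *.
assert (HL : L * s ^ 5 = 1) by (unfold L; field; lra).
assert (HL0 : 0 < L) by (unfold L; now apply Rinv_0_lt_compat).
assert (H8 : 0 < s ^ 8) by (apply pow_lt; lra).
set (J := INR j + / 2) in *.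
assert (HJ : 0 < J) by (apply (Rmult_lt_reg_l (s ^ 8)); lra).
assert (HL1 : 1 <= L).
{ apply (Rmult_le_reg_r (s ^ 5)); [easy|]. rewrite HL.
  assert (s ^ 5 <= s ^ 0) by (apply pow_le_base; [lra|lia]). simpl in *; lra. }
assert (Hy : (IZR x + / 2) ^ 2 <= (2 * L) ^ 2).
{ assert (Habs : forall y : Z, IZR y ^ 2 < L ^ 2 -> - L < IZR y < L) by (intros y Hy; split; nra).
  destruct Hx as [Hx|Hx]; apply cutoff_neq0, Habs in Hx; try easy.
  - nra.
  - rewrite plus_IZR in Hx; nra. }
replace (((IZR x + / 2) / J) ^ 2) with ((IZR x + / 2) ^ 2 / J ^ 2) by (field; lra).
apply Rle_div_l; [apply pow_lt; lra|].
apply Rle_trans with (1 := Hy).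
apply (Rmult_le_reg_l (s ^ 16)); [apply pow_lt; lra|].
replace (s ^ 16 * (2 * L) ^ 2) with (4 * s ^ 6 * (L * s ^ 5) ^ 2) by ring. rewrite HL.
replace (s ^ 16 * (s * J ^ 2)) with (s * (s ^ 8 * J) ^ 2) by ring.
assert (1 <= (s ^ 8 * J) ^ 2) by nra.
assert (s ^ 5 <= / 32).
{ assert (s ^ 5 <= (/ 2) ^ 5) by (apply pow_incr; lra). lra. }
replace (s ^ 6) with (s * s ^ 5) by ring. nra.
Qed.

(** * Comparison of the oscillator form with the Krawtchouk form under the cutoff *)

Definition hform (k : R) (f : Z -> R) (x : Z) : R :=
  (f (x + 1)%Z - f x) ^ 2 + k ^ 4 * (IZR x ^ 2 * f x ^ 2).

Lemma hform_ge0 (k : R) (f : Z -> R) (x : Z) : 0 <= hform k f x.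
Proof.
unfold hform; replace (k ^ 4) with ((k ^ 2) ^ 2) by ring.
pose proof (pow2_ge_0 (f (x + 1)%Z - f x)); pose proof (pow2_ge_0 (k ^ 2 * IZR x * f x)).
nra.
Qed.

Definition cut (s : R) (f : Z -> R) (x : Z) : R := cutoff (/ s ^ 5) x * f x.

Lemma cut_supp (s : R) (j : nat) (f : Z -> R) : scaled s j -> supp j (cut s f).
Proof.
intros H x Hx; unfold cut.
destruct (Req_dec (cutoff (/ s ^ 5) x) 0) as [->|h]; [ring|].
apply (scaled_radius s j x H) in h; lia.
Qed.

Lemma cut_sq_le (s : R) (f : Z -> R) (x : Z) : cut s f x ^ 2 <= f x ^ 2.
Proof.
unfold cut; pose proof (cutoff_range (/ s ^ 5) x) as h.
rewrite Rpow_mult_distr.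
assert (cutoff (/ s ^ 5) x ^ 2 <= 1) by nra. pose proof (pow2_ge_0 (f x)); nra.
Qed.

(** The sum of x^2 f(x)^2 is at most s^-16 times the energy, as k^4 = s^16. For energies of order
    s^8 the lost mass is therefore of order s^2. *)
Lemma cut_loss (s : R) (f : Z -> R) (N : nat) : 0 < s ->
  zsum N (fun x => f x ^ 2) - 2 * s ^ 10 * zsum N (fun x => IZR x ^ 2 * f x ^ 2)
  <= zsum N (fun x => cut s f x ^ 2).
Proof.
intros Hs; rewrite <- zsum_scal, <- zsum_minus; apply zsum_le; intros x _.
assert (H5 : 0 < s ^ 5) by now apply pow_lt.
assert (h := cutoff_loss (/ s ^ 5) x (Rinv_0_lt_compat _ H5)).
replace (2 * (IZR x ^ 2 / (/ s ^ 5) ^ 2)) with (2 * s ^ 10 * IZR x ^ 2) in h by (field; lra).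
unfold cut; rewrite Rpow_mult_distr. pose proof (pow2_ge_0 (f x)); nra.
Qed.

(** The parameter of the weighted square inequality is taken to be s itself: the gradient of the
    cutoff then costs (1 + 1/s) 9 s^10 <= 18 s^9, a factor s below k^2 = s^8. *)
Lemma cut_diff (s : R) (f : Z -> R) (x : Z) : 0 < s <= / 2 ->
  (cut s f (x + 1)%Z - cut s f x) ^ 2
  <= (1 + s) * (cutoff (/ s ^ 5) (x + 1) ^ 2 * (f (x + 1)%Z - f x) ^ 2)
     + 18 * s ^ 9 * f x ^ 2.
Proof.
intros Hs. assert (H5 : 0 < s ^ 5) by (apply pow_lt; lra).
assert (HL : 1 <= / s ^ 5).
{ rewrite <- Rinv_1; apply Rinv_le_contravar; [easy|].
  assert (s ^ 5 <= s ^ 0) by (apply pow_le_base; [lra|lia]); simpl in *; lra. }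
eapply Rle_trans; [apply (cutoff_diff s); [lra|exact HL]|].
apply Rplus_le_compat_l, Rmult_le_compat_r; [apply pow2_ge_0|].
replace ((1 + / s) * (9 / (/ s ^ 5) ^ 2)) with (9 * s ^ 9 * (1 + s)) by (field; lra).
assert (0 < s ^ 9) by (apply pow_lt; lra). nra.
Qed.

(** On bonds that meet the cutoff t <= s, so 1 - sqrt(1 - t) <= t/2 + t^2/2 <= (1 + s) t/2; the
    kinetic weight is simply bounded by 1. *)
Lemma kform_cut_le (s : R) (j : nat) (f : Z -> R) (x : Z) : scaled s j ->
  let g := cut s f in
  kform j g x <= (g (x + 1)%Z - g x) ^ 2
    + (1 + s) / (INR j + / 2) ^ 2 * ((IZR x + / 2) ^ 2 * ((g x ^ 2 + g (x + 1)%Z ^ 2) / 2)).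
Proof.
intros H g; unfold kform, bond.
destruct (classic (cutoff (/ s ^ 5) x = 0 /\ cutoff (/ s ^ 5) (x + 1) = 0)) as [[h1 h2]|h].
{ unfold g, cut; rewrite h1, h2; unfold Rdiv; ring_simplify; lra. }
assert (Ht := scaled_bond s j x H ltac:(tauto)).
destruct H as [Hs Hj].
assert (HJ : 0 < INR j + / 2) by (pose proof (pos_INR j); lra).
set (t := ((IZR x + / 2) / (INR j + / 2)) ^ 2) in *.
replace ((1 + s) / (INR j + / 2) ^ 2 * ((IZR x + / 2) ^ 2 * ((g x ^ 2 + g (x + 1)%Z ^ 2) / 2)))
  with ((1 + s) * (t / 2) * (g x ^ 2 + g (x + 1)%Z ^ 2)) by (unfold t; field; lra).
destruct (sqrt_1m_bounds t ltac:(lra)) as [_ [Hr Hr']]; set (r := sqrt (1 - t)) in *.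
set (d := (g (x + 1)%Z - g x) ^ 2); set (e := g x ^ 2 + g (x + 1)%Z ^ 2).
assert (0 <= d) by apply pow2_ge_0.
assert (0 <= e) by (unfold e; pose proof (pow2_ge_0 (g x)); pose proof (pow2_ge_0 (g (x + 1)%Z)); lra).
assert (1 - r <= (1 + s) * (t / 2)) by nra.
assert (r <= 1) by lra.
assert (r * d <= d) by nra. nra.
Qed.

Lemma scaled_inv_sq (s : R) (j : nat) : scaled s j -> / (INR j + / 2) ^ 2 <= s ^ 16.
Proof.
intros [Hs Hj]. assert (HJ : 0 < INR j + / 2) by (pose proof (pos_INR j); lra).
set (J := INR j + / 2) in *.
apply (Rmult_le_reg_r (J ^ 2)); [now apply pow_lt|].
rewrite Rinv_l by (apply pow_nonzero; lra).
replace (s ^ 16 * J ^ 2) with ((s ^ 8 * J) ^ 2) by ring. nra.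
Qed.

(** The Krawtchouk lower bound for the cut function, rewritten in terms of f. The mass loss is 2 Q /
    s^6; in 19 s^9 the gradient of the cutoff accounts for 18 and the constant 1/4 of the bond
    potential, which carries s^16, for the rest. *)
Lemma cut_lower (n j N : nat) (s : R) (f : Z -> R) :
  scaled s j -> (n <= 2 * j)%nat -> (j < N)%nat ->
  (forall i, (i < n)%nat -> zsum j (fun x => cut s f x * zkvec j i x) = 0) ->
  let Q := zsum N (hform (s ^ 4) f) in
  let S := zsum N (fun x => f x ^ 2) in
  (2 * INR n + 1) * (S - 2 * (Q / s ^ 6)) <= (INR j + / 2) * ((1 + s) * Q + 19 * s ^ 9 * S).
Proof.
intros H Hn HN Horth Q S0.
assert (HK := kform_lower n j (cut s f) Hn (cut_supp s j f H) Horth).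
assert (Hsc := H); destruct Hsc as [Hs Hj].
assert (HJ : 0 < INR j + / 2) by (pose proof (pos_INR j); lra).
assert (HX : s ^ 16 * zsum N (fun x => IZR x ^ 2 * f x ^ 2) <= Q).
{ unfold Q; rewrite <- zsum_scal; apply zsum_le; intros x _; unfold hform.
  pose proof (pow2_ge_0 (f (x + 1)%Z - f x)). replace ((s ^ 4) ^ 4) with (s ^ 16) by ring. lra. }
assert (HS : S0 - 2 * (Q / s ^ 6) <= zsum j (fun x => cut s f x ^ 2)).
{ rewrite <- (zsum_support j N (fun x => cut s f x ^ 2));
    [|lia|intros; rewrite (cut_supp s j f H) by easy; ring].
  eapply Rle_trans; [|apply cut_loss; lra]. fold S0.
  apply Rplus_le_compat_l, Ropp_le_contravar.
  rewrite Rmult_assoc; apply Rmult_le_compat_l; [lra|].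
  assert (0 < s ^ 6) by (apply pow_lt; lra).
  apply (Rle_div_r _ _ (s ^ 6)); [easy|]. eapply Rle_trans; [|apply HX]. right; ring. }
eapply Rle_trans; [apply Rmult_le_compat_l, HS; pose proof (pos_INR n); lra|].
eapply Rle_trans; [apply HK|]. apply Rmult_le_compat_l; [lra|].
eapply Rle_trans; [apply zsum_le; intros x _; apply kform_cut_le, H|].
rewrite zsum_plus, zsum_scal.
rewrite (zsum_bond_potential j) by (try lia; now apply cut_supp).
apply Rle_trans with (zsum (S j) (fun x => (1 + s) * hform (s ^ 4) f x + 19 * s ^ 9 * f x ^ 2)).
- rewrite <- zsum_scal, <- zsum_plus; apply zsum_le; intros x _.
  assert (h1 := cut_diff s f x Hs). assert (h2 := cut_sq_le s f x).
  assert (h3 := cutoff_range (/ s ^ 5) (x + 1)).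
  assert (h4 := scaled_inv_sq s j H).
  assert (h5 : (1 + s) * (cutoff (/ s ^ 5) (x + 1) ^ 2 * (f (x + 1)%Z - f x) ^ 2)
    <= (1 + s) * (f (x + 1)%Z - f x) ^ 2).
  { apply Rmult_le_compat_l; [lra|]. assert (cutoff (/ s ^ 5) (x + 1) ^ 2 <= 1) by nra.
    pose proof (pow2_ge_0 (f (x + 1)%Z - f x)); nra. }
  assert (h6 : (1 + s) / (INR j + / 2) ^ 2 * ((IZR x ^ 2 + / 4) * cut s f x ^ 2)
    <= (1 + s) * s ^ 16 * ((IZR x ^ 2 + / 4) * f x ^ 2)).
  { pose proof (pow2_ge_0 (IZR x)); pose proof (pow2_ge_0 (cut s f x)).
    assert (0 < / (INR j + / 2) ^ 2) by now apply Rinv_0_lt_compat, pow_lt.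
    apply Rmult_le_compat; [unfold Rdiv; nra|nra|unfold Rdiv; nra|nra]. }
  assert (h7 : s ^ 16 <= s ^ 9) by (apply pow_le_base; [lra|lia]).
  assert (h8 : (1 + s) * s ^ 16 * (/ 4 * f x ^ 2) <= s ^ 9 * f x ^ 2).
  { rewrite <- Rmult_assoc; apply Rmult_le_compat_r; [apply pow2_ge_0|].
    assert (0 < s ^ 16) by (apply pow_lt; lra). nra. }
  unfold hform. replace ((s ^ 4) ^ 4) with (s ^ 16) by ring. lra.
- rewrite zsum_plus, 2!zsum_scal.
  assert (0 < s ^ 9) by (apply pow_lt; lra).
  apply Rplus_le_compat; apply Rmult_le_compat_l; try lra; apply zsum_window_le; try lia.
  + apply hform_ge0.
  + intros; apply pow2_ge_0.
Qed.

(** The inequality 1 - sqrt(1 - t) >= t/2 holds for all t in [0, 1], hence on the whole lattice. The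
    form thus controls the full harmonic potential before any cutoff, which localises low Krawtchouk
    states. *)
Lemma kform_ge (j : nat) (u : Z -> R) (x : Z) : supp j u -> (- Z.of_nat j - 1 <= x)%Z ->
  bond j x * (u (x + 1)%Z - u x) ^ 2
    + / (INR j + / 2) ^ 2 * ((IZR x + / 2) ^ 2 * ((u x ^ 2 + u (x + 1)%Z ^ 2) / 2))
  <= kform j u x.
Proof.
intros Hu Hx.
destruct (Z_lt_le_dec (Z.of_nat j) x) as [h|h].
{ unfold kform; rewrite !(Hu x), !(Hu (x + 1)%Z) by lia. lra. }
assert (HJ : 0 < INR j + / 2) by (pose proof (pos_INR j); lra).
assert (h1 : IZR x <= INR j) by (rewrite INR_IZR_INZ; now apply IZR_le).
assert (h2 : - INR j - 1 <= IZR x).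
{ rewrite INR_IZR_INZ, <- opp_IZR, <- minus_IZR; now apply IZR_le. }
unfold kform, bond; set (t := ((IZR x + / 2) / (INR j + / 2)) ^ 2).
replace (/ (INR j + / 2) ^ 2 * ((IZR x + / 2) ^ 2 * ((u x ^ 2 + u (x + 1)%Z ^ 2) / 2)))
  with (t / 2 * (u x ^ 2 + u (x + 1)%Z ^ 2)) by (unfold t; field; lra).
assert (Ht : 0 <= t <= 1).
{ split; [apply pow2_ge_0|]. unfold t.
  replace (((IZR x + / 2) / (INR j + / 2)) ^ 2) with ((IZR x + / 2) ^ 2 / (INR j + / 2) ^ 2)
    by (field; lra).
  apply Rle_div_l; [now apply pow_lt|]. nra. }
destruct (sqrt_1m_bounds t Ht) as [_ [_ Hr]].
apply Rplus_le_compat_l, Rmult_le_compat_r; [|lra].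
pose proof (pow2_ge_0 (u x)); pose proof (pow2_ge_0 (u (x + 1)%Z)); lra.
Qed.

(** The converse transfer. The form of u dominates a weighted kinetic part B plus a potential P. P
    bounds the mass lost by the cutoff, and on the remaining bonds the weights in B are at least 1 -
    s, so that B controls the true kinetic energy. *)
Lemma cut_upper (j : nat) (s a : R) (u : Z -> R) :
  scaled s j -> supp j u -> 0 <= a ->
  (INR j + / 2) * zsum (S j) (kform j u) <= a * zsum j (fun x => u x ^ 2) ->
  zsum (S j) (hform (s ^ 4) (cut s u))
    <= s ^ 8 * ((1 + 4 * s) * a + 18 * s) * zsum j (fun x => u x ^ 2) /\
  (1 - 4 * s ^ 2 * a) * zsum j (fun x => u x ^ 2) <= zsum j (fun x => cut s u x ^ 2).
Proof.
intros H Hu Ha HK. set (Su := zsum j (fun x => u x ^ 2)) in *.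
assert (HSu : 0 <= Su) by (apply zsum_ge0; intros; apply pow2_ge_0).
assert (Hsc := H); destruct Hsc as [Hs Hj].
assert (HJ : 0 < INR j + / 2) by (pose proof (pos_INR j); lra).
assert (H8 : 0 < s ^ 8) by (apply pow_lt; lra).
set (B := zsum (S j) (fun x => bond j x * (u (x + 1)%Z - u x) ^ 2)).
set (P := / (INR j + / 2) ^ 2 * zsum (S j) (fun x => (IZR x ^ 2 + / 4) * u x ^ 2)).
assert (HB : 0 <= B).
{ apply zsum_ge0; intros; apply Rmult_le_pos; [apply sqrt_pos|apply pow2_ge_0]. }
assert (HP : 0 <= P).
{ apply Rmult_le_pos; [now apply Rlt_le, Rinv_0_lt_compat, pow_lt|].
  apply zsum_ge0; intros x _. pose proof (pow2_ge_0 (IZR x)); pose proof (pow2_ge_0 (u x)); nra. }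
assert (HBP : B + P <= zsum (S j) (kform j u)).
{ unfold P; rewrite <- (zsum_bond_potential j) by (easy || lia).
  rewrite <- zsum_scal; unfold B; rewrite <- zsum_plus; apply zsum_le; intros x Hx.
  apply kform_ge; [easy|lia]. }
assert (HJBP : (INR j + / 2) * (B + P) <= a * Su).
{ eapply Rle_trans; [apply Rmult_le_compat_l, HBP; lra|easy]. }
set (J := INR j + / 2) in *.
assert (HXP : zsum (S j) (fun x => IZR x ^ 2 * u x ^ 2) <= J ^ 2 * P).
{ unfold P; rewrite <- Rmult_assoc, Rinv_r, Rmult_1_l by (apply pow_nonzero; lra).
  apply zsum_le; intros x _. pose proof (pow2_ge_0 (u x)); lra. }
assert (Hu2 : zsum (S j) (fun x => u x ^ 2) = Su).
{ apply zsum_support; [lia|intros; rewrite Hu by easy; ring]. }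
assert (Hsmall : s ^ 8 <= s ^ 2 * / 64).
{ assert (s ^ 6 <= (/ 2) ^ 6) by (apply pow_incr; lra).
  assert (0 < s ^ 2) by (apply pow_lt; lra).
  replace (s ^ 8) with (s ^ 2 * s ^ 6) by ring. nra. }
split.
- assert (Hpt : zsum (S j) (hform (s ^ 4) (cut s u)) <= (1 + 4 * s) * (B + P) + 18 * s ^ 9 * Su).
  { rewrite <- Hu2.
    apply Rle_trans with ((1 + 4 * s) * B + s ^ 16 * zsum (S j) (fun x => IZR x ^ 2 * u x ^ 2)
      + 18 * s ^ 9 * zsum (S j) (fun x => u x ^ 2)).
    - unfold B; rewrite <- 3!zsum_scal, <- 2!zsum_plus; apply zsum_le; intros x _.
      assert (h1 := cut_diff s u x Hs). assert (h2 := cut_sq_le s u x).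
      assert (h3 := cutoff_range (/ s ^ 5) (x + 1)).
      (* Where the cutoff is non-zero the bond weight is at least 1 - s, and 1 + s <= (1 + 4 s) (1 -
         s) for 0 <= s <= 1/2. *)
      assert (h4 : (1 + s) * (cutoff (/ s ^ 5) (x + 1) ^ 2 * (u (x + 1)%Z - u x) ^ 2)
         <= (1 + 4 * s) * (bond j x * (u (x + 1)%Z - u x) ^ 2)).
      { rewrite <- 2!Rmult_assoc; apply Rmult_le_compat_r; [apply pow2_ge_0|].
        assert (0 <= bond j x) by apply sqrt_pos.
        destruct (Req_dec (cutoff (/ s ^ 5) (x + 1)) 0) as [->|h]; [nra|].
        assert (Ht := scaled_bond s j x H ltac:(tauto)).
        unfold bond; fold J in Ht |- *; set (t := ((IZR x + / 2) / J) ^ 2) in *.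
        destruct (sqrt_1m_bounds t ltac:(lra)) as [Hr _]; set (r := sqrt (1 - t)) in *.
        assert (1 - s <= r) by lra.
        assert (cutoff (/ s ^ 5) (x + 1) ^ 2 <= 1) by nra. nra. }
      unfold hform. replace ((s ^ 4) ^ 4) with (s ^ 16) by ring.
      assert (h5 : s ^ 16 * (IZR x ^ 2 * cut s u x ^ 2) <= s ^ 16 * (IZR x ^ 2 * u x ^ 2)).
      { apply Rmult_le_compat_l; [apply pow_le; lra|].
        apply Rmult_le_compat_l; [apply pow2_ge_0|easy]. }
      lra.
    - apply Rplus_le_compat_r. rewrite Rmult_plus_distr_l; apply Rplus_le_compat_l.
      eapply Rle_trans; [apply Rmult_le_compat_l, HXP; apply pow_le; lra|].
      rewrite <- Rmult_assoc; apply Rmult_le_compat_r; [easy|].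
      replace (s ^ 16 * J ^ 2) with ((s ^ 8 * J) ^ 2) by ring.
      assert (s ^ 8 <= / 2 * s) by nra.
      assert ((s ^ 8 * J) ^ 2 <= (1 + 2 * s ^ 8) ^ 2) by (apply pow_incr; lra). nra. }
  eapply Rle_trans; [exact Hpt|].
  assert (HBP2 : B + P <= s ^ 8 * (a * Su)).
  { apply (Rmult_le_reg_l J); [easy|]. eapply Rle_trans; [exact HJBP|].
    assert (0 <= a * Su) by now apply Rmult_le_pos. nra. }
  assert (h := Rmult_le_compat_l (1 + 4 * s) _ _ ltac:(lra) HBP2).
  eapply Rle_trans; [apply Rplus_le_compat_r, h|]. right; ring.
- rewrite <- (zsum_support j (S j) (fun x => cut s u x ^ 2));
    [|lia|intros; rewrite (cut_supp s j u H) by easy; ring].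
  eapply Rle_trans; [|apply cut_loss; lra]. rewrite Hu2.
  assert (HX2 : zsum (S j) (fun x => IZR x ^ 2 * u x ^ 2) <= J * (a * Su)).
  { eapply Rle_trans; [exact HXP|]. replace (J ^ 2 * P) with (J * (J * P)) by ring.
    apply Rmult_le_compat_l; [lra|]. nra. }
  assert (h := Rmult_le_compat_l (2 * s ^ 10) _ _ ltac:(apply Rmult_le_pos; [lra|apply pow_le; lra]) HX2).
  assert (h2 : 2 * s ^ 10 * (J * (a * Su)) <= 4 * s ^ 2 * (a * Su)).
  { replace (2 * s ^ 10 * (J * (a * Su))) with (2 * (s ^ 8 * J) * s ^ 2 * (a * Su)) by ring.
    apply Rmult_le_compat_r; [now apply Rmult_le_pos|].
    apply Rmult_le_compat_r; [apply pow2_ge_0|].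
    assert (s ^ 2 <= 1) by nra. lra. }
  lra.
Qed.

(** * Lower bound *)

Definition boundary (f g : Z -> R) (N : nat) : R :=
  f (- Z.of_nat N)%Z * (g (- Z.of_nat N)%Z - g (- Z.of_nat (S N))%Z)
  - f (Z.of_nat (S N)) * (g (Z.of_nat (S N)) - g (Z.of_nat N)).

Lemma zsum_Hk (k : R) (f g : Z -> R) (N : nat) :
  zsum N (fun x => f x * Hk k g x)
  = zsum N (fun x => (f (x + 1)%Z - f x) * (g (x + 1)%Z - g x) + k ^ 4 * (IZR x ^ 2 * (f x * g x)))
    + boundary f g N.
Proof.
set (p := fun x => f x * (g x - g (x - 1)%Z)).
rewrite (zsum_ext N _ (fun x => ((f (x + 1)%Z - f x) * (g (x + 1)%Z - g x)
   + k ^ 4 * (IZR x ^ 2 * (f x * g x))) + - 1 * (p (x + 1)%Z - p x))).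
- rewrite zsum_plus, zsum_scal, zsum_telescope. unfold p, boundary.
  replace (Z.of_nat N + 1 - 1)%Z with (Z.of_nat N) by lia.
  replace (Z.of_nat N + 1)%Z with (Z.of_nat (S N)) by lia.
  replace (- Z.of_nat N - 1)%Z with (- Z.of_nat (S N))%Z by lia. ring.
- intros x _; unfold p, Hk. replace (x + 1 - 1)%Z with x by lia. ring.
Qed.

Lemma zsum_Hk_diag (k : R) (f : Z -> R) (N : nat) :
  zsum N (fun x => f x * Hk k f x) = zsum N (hform k f) + boundary f f N.
Proof. rewrite zsum_Hk; f_equal; apply zsum_ext; intros; unfold hform; ring. Qed.

Lemma zsum_Hk_sym (k : R) (f g : Z -> R) (N : nat) :
  zsum N (fun x => f x * Hk k g x) - zsum N (fun x => g x * Hk k f x)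
  = boundary f g N - boundary g f N.
Proof.
rewrite !zsum_Hk.
rewrite (zsum_ext N (fun x => (g (x + 1)%Z - g x) * (f (x + 1)%Z - f x) + k ^ 4 * (IZR x ^ 2 * (g x * f x)))
  (fun x => (f (x + 1)%Z - f x) * (g (x + 1)%Z - g x) + k ^ 4 * (IZR x ^ 2 * (f x * g x))))
  by (intros; ring). ring.
Qed.

(** Inner products are handled as limits of window sums; decay at both ends makes the boundary terms
    of summation by parts disappear there. *)
Definition vanishing (f : Z -> R) : Prop :=
  is_lim_seq (fun N => f (Z.of_nat N)) 0 /\ is_lim_seq (fun N => f (- Z.of_nat N)%Z) 0.

Lemma is_lim_seq_sq0 (u : nat -> R) : is_lim_seq (fun N => u N ^ 2) 0 -> is_lim_seq u 0.
Proof.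
intros H; apply is_lim_seq_abs_0.
apply is_lim_seq_ext with (fun N => sqrt (u N ^ 2)).
- intros; now rewrite <- Rsqr_pow2, sqrt_Rsqr_abs.
- rewrite <- sqrt_0; apply (is_lim_seq_continuous sqrt); [|easy].
  apply continuity_pt_sqrt; lra.
Qed.

Lemma l2_vanishing (f : Z -> R) : l2 f -> vanishing f.
Proof. intros [H1 H2]; split; apply is_lim_seq_sq0; now apply ex_series_lim_0. Qed.

Lemma is_lim_seq_plus0 (u v : nat -> R) :
  is_lim_seq u 0 -> is_lim_seq v 0 -> is_lim_seq (fun N => u N + v N) 0.
Proof. intros H1 H2; replace 0 with (0 + 0) by ring; now apply is_lim_seq_plus'. Qed.

Lemma is_lim_seq_minus0 (u v : nat -> R) :
  is_lim_seq u 0 -> is_lim_seq v 0 -> is_lim_seq (fun N => u N - v N) 0.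
Proof. intros H1 H2; replace 0 with (0 - 0) by ring; now apply is_lim_seq_minus'. Qed.

Lemma is_lim_seq_scal0 (a : R) (u : nat -> R) :
  is_lim_seq u 0 -> is_lim_seq (fun N => a * u N) 0.
Proof. intros H; replace 0 with (a * 0) by ring; now apply is_lim_seq_mult'; [apply is_lim_seq_const|]. Qed.

Lemma is_lim_seq_sumn0 (m : nat) (F : nat -> nat -> R) :
  (forall i, (i < m)%nat -> is_lim_seq (F i) 0) ->
  is_lim_seq (fun N => sumn m (fun i => F i N)) 0.
Proof.
induction m as [|m IH]; intros H; simpl; [apply is_lim_seq_const|].
apply is_lim_seq_plus0; [apply IH; intros|]; apply H; lia.
Qed.

Lemma boundary_lim (f g : Z -> R) : vanishing f -> vanishing g ->
  is_lim_seq (boundary f g) 0.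
Proof.
intros [Hf1 Hf2] [Hg1 Hg2]; unfold boundary.
assert (Hf1' := proj1 (is_lim_seq_incr_1 _ _) Hf1).
assert (Hg1' := proj1 (is_lim_seq_incr_1 _ _) Hg1).
assert (Hg2' := proj1 (is_lim_seq_incr_1 _ _) Hg2).
apply is_lim_seq_minus0; replace 0 with (0 * 0) by ring;
  (apply is_lim_seq_mult'; [easy|now apply is_lim_seq_minus0]).
Qed.

Lemma eigenvectors_orth (k mu nu : R) (f g : Z -> R) :
  eigenvector k f mu -> eigenvector k g nu -> mu <> nu ->
  is_lim_seq (fun N => zsum N (fun x => f x * g x)) 0.
Proof.
intros (Hf & _ & Ef) (Hg & _ & Eg) Hne.
apply is_lim_seq_ext with (fun N => / (nu - mu) * (boundary f g N - boundary g f N)).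
- intros N; rewrite <- (zsum_Hk_sym k), <- zsum_minus, <- zsum_scal.
  apply zsum_ext; intros; rewrite Ef, Eg; field; lra.
- apply is_lim_seq_scal0, is_lim_seq_minus0; apply boundary_lim; now apply l2_vanishing.
Qed.

Lemma Hk_sumn (k : R) (m : nat) (c : nat -> R) (f : nat -> Z -> R) (x : Z) :
  Hk k (fun y => sumn m (fun i => c i * f i y)) x = sumn m (fun i => c i * Hk k (f i) x).
Proof. unfold Hk; induction m as [|m IH]; cbn [sumn]; [ring|rewrite <- IH; ring]. Qed.

(** Within one eigenspace the f_i are not assumed orthogonal, so the form is not diagonal in the
    c_i. The weights w_i = sqrt(lam - mu_i) avoid orthogonalisation: w_i - w_l vanishes for equal
    eigenvalues, and for distinct ones the window product of f_i and f_l tends to 0. *)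
Lemma eigenvectors_comb (k lam : R) (m : nat) (f : nat -> Z -> R) (mu c : nat -> R) (eps : R) :
  0 < eps ->
  (forall i, (i < m)%nat -> eigenvector k (f i) (mu i) /\ mu i <= lam) ->
  let u := fun x => sumn m (fun i => c i * f i x) in
  exists N0, forall N, (N0 <= N)%nat ->
    zsum N (hform k u) <= lam * zsum N (fun x => u x ^ 2) + eps.
Proof.
intros Heps He u.
assert (Hvan : vanishing u).
{ split; apply is_lim_seq_sumn0; intros i Hi; apply is_lim_seq_scal0;
  now apply l2_vanishing, He. }
set (w := fun i => sqrt (lam - mu i)).
assert (Hw : forall i, (i < m)%nat -> w i * w i = lam - mu i).
{ intros i Hi; apply sqrt_sqrt. destruct (He i Hi); lra. }
(* As (mu_i - mu_l) <f_i, f_l> = 0, the form sum_il c_i c_l (lam - mu_i) <f_i, f_l>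
   is the square norm of sum_i w_i c_i f_i *)
set (err := fun N => sumn m (fun i => sumn m (fun l =>
   c i * c l * w i * (w i - w l) * zsum N (fun x => f i x * f l x)))).
assert (Herr : is_lim_seq err 0).
{ apply is_lim_seq_sumn0; intros i Hi; apply is_lim_seq_sumn0; intros l Hl.
  destruct (Req_dec (mu i) (mu l)) as [h|h].
  - apply is_lim_seq_ext with (fun _ => 0); [|apply is_lim_seq_const].
    intros; unfold w; rewrite h; ring.
  - apply is_lim_seq_scal0. apply (eigenvectors_orth k (mu i) (mu l)); [now apply He|now apply He|easy]. }
assert (HN : forall N, lam * zsum N (fun x => u x ^ 2) - zsum N (fun x => u x * Hk k u x)
  = zsum N (fun x => sumn m (fun i => w i * c i * f i x) ^ 2) + err N).
{ intros N.
  assert (Herr' : err N = zsum N (fun x => sumn m (fun i => sumn m (fun l =>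
     c i * c l * w i * (w i - w l) * (f i x * f l x))))).
  { rewrite zsum_sumn; apply sumn_ext; intros i _.
    rewrite zsum_sumn; apply sumn_ext; intros l _. now rewrite zsum_scal. }
  rewrite Herr', <- zsum_scal, <- zsum_minus, <- zsum_plus; apply zsum_ext; intros x _.
  rewrite <- !Rsqr_pow2; unfold Rsqr.
  rewrite (sumn_mul m m (fun i => w i * c i * f i x)), <- sumn_plus.
  replace (Hk k u x) with (sumn m (fun i => c i * (mu i * f i x))).
  2:{ unfold u; rewrite Hk_sumn; apply sumn_ext; intros i Hi.
      destruct (He i Hi) as [(_ & _ & E) _]; now rewrite E. }
  transitivity (sumn m (fun i => c i * (lam - mu i) * f i x) * u x).
  { rewrite (sumn_ext _ (fun i => c i * (lam - mu i) * f i x)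
      (fun i => lam * (c i * f i x) + -1 * (c i * (mu i * f i x)))) by (intros; ring).
    rewrite sumn_plus, 2!sumn_scal; fold (u x); ring. }
  unfold u; rewrite sumn_mul; apply sumn_ext; intros i Hi.
  rewrite <- sumn_plus; apply sumn_ext; intros l Hl. rewrite <- Hw by easy; ring. }
assert (Hlim : is_lim_seq (fun N => err N + boundary u u N) 0)
  by (apply is_lim_seq_plus0; [easy|now apply boundary_lim]).
apply is_lim_seq_spec in Hlim; destruct (Hlim (mkposreal eps Heps)) as [N0 HN0]; simpl in HN0.
exists N0; intros N HN'. specialize (HN0 N HN'); specialize (HN N).
rewrite zsum_Hk_diag in HN.
assert (0 <= zsum N (fun x => sumn m (fun i => w i * c i * f i x) ^ 2))
  by (apply zsum_ge0; intros; apply pow2_ge_0).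
rewrite Rminus_0_r in HN0; apply Rabs_def2 in HN0; lra.
Qed.

(** Among the combinations of n + 1 eigenvectors, one is, after the cutoff, orthogonal to the first
    n Krawtchouk vectors. Its energy is at most s^8 Lam times its mass, and [cut_lower] divided by
    that mass becomes an inequality between numbers that is close to 2n + 1 <= Lam. *)
Lemma count_ge_lower (n j : nat) (s lam Lam : R) :
  scaled s j -> (n <= 2 * j)%nat -> count_ge (s ^ 4) n lam -> lam < s ^ 8 * Lam ->
  (2 * INR n + 1) * (1 - 2 * s ^ 2 * Lam) <= (1 + 2 * s ^ 8) * ((1 + s) * Lam + 19 * s).
Proof.
intros H Hn (f & mu & Hli & He) Hlam.
destruct (linear_system_nontrivial n (fun l i => zsum j (fun x => cut s (f i) x * zkvec j l x)))
  as (c & (p & Hp & Hcp) & Hc).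
set (u := fun x => sumn (S n) (fun i => c i * f i x)).
assert (Hu : exists x, u x <> 0).
{ apply not_all_not_ex; intros Hall; apply Hcp, Hli; [|easy].
  intros x; rewrite sum_f_R0_sumn. specialize (Hall x). now apply NNPP in Hall. }
destruct Hu as [x0 Hx0].
assert (Hpos : 0 < u x0 ^ 2) by now apply pow2_gt_0.
(* The strict gap between lam and s^8 Lam pays for the window error: every window containing x0 has
   mass at least u(x0)^2. *)
assert (Heps : 0 < (s ^ 8 * Lam - lam) * u x0 ^ 2) by (apply Rmult_lt_0_compat; lra).
destruct (eigenvectors_comb (s ^ 4) lam (S n) f mu c _ Heps) as [N0 HN0].
{ intros i Hi; apply He; lia. }
set (N := (N0 + S j + Z.to_nat (Z.abs x0))%nat).
specialize (HN0 N ltac:(unfold N; lia)).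
change (zsum N (hform (s ^ 4) u) <= lam * zsum N (fun x => u x ^ 2)
  + (s ^ 8 * Lam - lam) * u x0 ^ 2) in HN0.
assert (Horth : forall i, (i < n)%nat -> zsum j (fun x => cut s u x * zkvec j i x) = 0).
{ intros i Hi; rewrite <- (Hc i Hi).
  rewrite (zsum_ext j _ (fun x => sumn (S n) (fun l => c l * (cut s (f l) x * zkvec j i x)))).
  - rewrite zsum_sumn; apply sumn_ext; intros l Hl; rewrite zsum_scal; ring.
  - intros x _; unfold cut, u.
    transitivity ((cutoff (/ s ^ 5) x * zkvec j i x) * sumn (S n) (fun l => c l * f l x)); [ring|].
    rewrite <- sumn_scal; apply sumn_ext; intros; ring. }
assert (HC := cut_lower n j N s u H Hn ltac:(unfold N; lia) Horth); cbv zeta in HC.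
set (Q := zsum N (hform (s ^ 4) u)) in *; set (S0 := zsum N (fun x => u x ^ 2)) in *.
assert (HS0 : u x0 ^ 2 <= S0).
{ apply (zsum_term_le N (fun x => u x ^ 2)); [unfold N; lia|intros; apply pow2_ge_0]. }
assert (HQ0 : 0 <= Q) by (apply zsum_ge0; intros; apply hform_ge0).
assert (HQ : Q <= s ^ 8 * Lam * S0).
{ assert (0 <= (s ^ 8 * Lam - lam) * (S0 - u x0 ^ 2)) by (apply Rmult_le_pos; lra). lra. }
destruct H as [Hs Hj].
assert (H8 : 0 < s ^ 8) by (apply pow_lt; lra).
assert (H6 : 0 < s ^ 6) by (apply pow_lt; lra).
assert (H9 : 0 < s ^ 9) by (apply pow_lt; lra).
assert (Ha := pos_INR n).
apply (Rmult_le_reg_l (s ^ 8 * S0)); [nra|].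
apply Rle_trans with (s ^ 8 * ((2 * INR n + 1) * (S0 - 2 * (Q / s ^ 6)))).
{ replace (s ^ 8 * S0 * ((2 * INR n + 1) * (1 - 2 * s ^ 2 * Lam)))
    with (s ^ 8 * ((2 * INR n + 1) * (S0 - 2 * (s ^ 8 * Lam * S0 / s ^ 6)))) by (field; lra).
  apply Rmult_le_compat_l; [lra|]. apply Rmult_le_compat_l; [lra|].
  apply Rplus_le_compat_l, Ropp_le_contravar, Rmult_le_compat_l; [lra|].
  apply Rmult_le_compat_r; [now apply Rlt_le, Rinv_0_lt_compat|easy]. }
eapply Rle_trans; [apply Rmult_le_compat_l, HC; lra|].
set (J := INR j + / 2) in *.
apply Rle_trans with ((1 + 2 * s ^ 8) * ((1 + s) * (s ^ 8 * Lam * S0) + 19 * s ^ 9 * S0)).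
- rewrite <- Rmult_assoc.
  assert (0 <= 19 * s ^ 9 * S0) by (apply Rmult_le_pos; nra).
  apply Rmult_le_compat; [lra|nra|lra|nra].
- right; ring.
Qed.

(** * Limits along an ultrafilter *)

(** Along such a U all bounded sequences converge at once: the values at every integer and the
    eigenvalues need no diagonal extraction of subsequences. Containing all tails makes the limit
    depend on large indices only. *)
Definition free_ultrafilter (U : (nat -> Prop) -> Prop) : Prop :=
  ProperFilter U /\ (forall P : nat -> Prop, U P \/ U (fun p => ~ P p)) /\
  forall N, U (fun p => (N <= p)%nat).

Lemma free_ultrafilter_exists : exists U, free_ultrafilter U.
Proof.
set (F := fun P : nat -> Prop => exists N, forall p, (N <= p)%nat -> P p).
assert (HF : @filter.ProperFilter nat F).
{ constructor.
  - intros [N HN]; apply (HN N); lia.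
  - constructor.
    + now exists O.
    + intros P Q [N HN] [M HM]; exists (N + M)%nat; intros p Hp.
      split; [apply HN|apply HM]; lia.
    + intros P Q HPQ [N HN]; exists N; intros p Hp; apply HPQ, HN, Hp. }
destruct (filter.ultraFilterLemma HF) as (U & HU & HFU).
exists U. assert (HP := @filter.ultra_proper _ _ HU).
assert (HUf := @filter.filter_filter _ _ HP).
repeat split.
(* The target notion of proper filter asks for a point in every member, the source notion that the
   empty set be no member. *)
- intros P HUP; apply not_all_not_ex; intros Hno.
  apply (@filter.filter_not_empty _ _ HP).
  apply (@filter.filterS _ _ HUf P); [|easy]. intros p Hp; now elim (Hno p).
- apply (@filter.filterT _ _ HUf).
- intros P Q; apply (@filter.filterI _ _ HUf).
- intros P Q HPQ; apply (@filter.filterS _ _ HUf); exact HPQ.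
- intros P; apply filter.in_ultra_setVsetC; exact HU.
- intros N; apply HFU; now exists N.
Qed.

Definition ulim (U : (nat -> Prop) -> Prop) (a : nat -> R) (l : R) : Prop :=
  filterlim a U (locally l).

(** The limit is the supremum of the c that are lower bounds of a on a set of U; maximality of U
    turns failure of l + eps <= a p on such a set into its negation on one. *)
Lemma ulim_bounded (U : (nat -> Prop) -> Prop) (a : nat -> R) (M : R) :
  free_ultrafilter U -> (forall p, Rabs (a p) <= M) -> exists l, ulim U a l.
Proof.
intros (HP & HU & _) Ha.
assert (HF := @filter_filter _ _ HP).
set (A := fun c => U (fun p => c <= a p)).
assert (HA : forall c, A c -> c <= M).
{ intros c Hc; destruct (filter_ex _ Hc) as [p Hp].
  specialize (Ha p); apply Rabs_le_between in Ha; lra. }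
destruct (completeness A) as [l [Hub Hlub]].
{ now exists M. }
{ exists (- M). unfold A; apply filter_forall; intros p.
  specialize (Ha p); apply Rabs_le_between in Ha; lra. }
exists l; intros P [eps HPe].
destruct (HU (fun p => l + eps <= a p)) as [h|h].
{ specialize (Hub _ h); destruct eps as [e He]; simpl in *; lra. }
destruct (classic (exists c, A c /\ l - eps < c)) as [(c & Hc & Hlc)|Hno].
- unfold filtermap. apply filter_imp with (fun p => ~ (l + eps <= a p) /\ c <= a p); [|now apply filter_and].
  intros p [h1 h2]; apply HPe. apply Rabs_def1; unfold minus, plus, opp; simpl; lra.
- assert (l <= l - eps); [|destruct eps as [e He]; simpl in *; lra].
  apply Hlub; intros c Hc; apply Rnot_lt_le; intros h1; apply Hno; now exists c.
Qed.

Lemma ulim_unique (U : (nat -> Prop) -> Prop) (a : nat -> R) (l l' : R) :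
  free_ultrafilter U -> ulim U a l -> ulim U a l' -> l = l'.
Proof. intros (HP & _) H H'; exact (@filterlim_locally_unique _ _ _ U (Proper_StrongProper _ HP) a l l' H H'). Qed.

Lemma ulim_ext (U : (nat -> Prop) -> Prop) (a b : nat -> R) (l : R) (N : nat) :
  free_ultrafilter U -> (forall p, (N <= p)%nat -> a p = b p) -> ulim U a l -> ulim U b l.
Proof.
intros (HP & _ & HN) H; assert (HF := @filter_filter _ _ HP).
apply filterlim_ext_loc. apply (filter_imp _ _ H), HN.
Qed.

Lemma ulim_const (U : (nat -> Prop) -> Prop) (c : R) :
  free_ultrafilter U -> ulim U (fun _ => c) c.
Proof. intros (HP & _); assert (HF := @filter_filter _ _ HP). apply filterlim_const. Qed.

Lemma ulim_plus (U : (nat -> Prop) -> Prop) (a b : nat -> R) (l m : R) :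
  free_ultrafilter U -> ulim U a l -> ulim U b m -> ulim U (fun p => a p + b p) (l + m).
Proof.
intros (HP & _) Ha Hb; assert (HF := @filter_filter _ _ HP).
exact (filterlim_comp_2 _ _ Rplus Ha Hb (filterlim_plus l m)).
Qed.

Lemma ulim_mult (U : (nat -> Prop) -> Prop) (a b : nat -> R) (l m : R) :
  free_ultrafilter U -> ulim U a l -> ulim U b m -> ulim U (fun p => a p * b p) (l * m).
Proof.
intros (HP & _) Ha Hb; assert (HF := @filter_filter _ _ HP).
exact (filterlim_comp_2 _ _ Rmult Ha Hb (filterlim_mult l m)).
Qed.

Lemma ulim_sq (U : (nat -> Prop) -> Prop) (a : nat -> R) (l : R) :
  free_ultrafilter U -> ulim U a l -> ulim U (fun p => a p ^ 2) (l ^ 2).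
Proof.
intros HU Ha; replace (l ^ 2) with (l * l) by ring.
apply (ulim_ext U (fun p => a p * a p) _ _ O HU); [intros; ring|now apply ulim_mult].
Qed.

Lemma ulim_le (U : (nat -> Prop) -> Prop) (a b : nat -> R) (l m : R) (N : nat) :
  free_ultrafilter U -> (forall p, (N <= p)%nat -> a p <= b p) ->
  ulim U a l -> ulim U b m -> l <= m.
Proof.
intros (HP & _ & HN) H Ha Hb; assert (HF := @filter_filter _ _ HP).
apply (filterlim_le (F := U) a b (Finite l) (Finite m)); [|easy|easy].
apply (filter_imp _ _ H), HN.
Qed.

Lemma ulim_zsum (U : (nat -> Prop) -> Prop) (N : nat) (a : nat -> Z -> R) (l : Z -> R) :
  free_ultrafilter U -> (forall x, ulim U (fun p => a p x) (l x)) ->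
  ulim U (fun p => zsum N (a p)) (zsum N l).
Proof. intros HU H; induction N as [|N IH]; cbn [zsum]; [apply H|]. repeat apply ulim_plus; easy. Qed.

(** * Eigenvectors of the truncated operators *)

Lemma zsum_Hk_supp_sym (k : R) (N : nat) (f g : Z -> R) : supp N f -> supp N g ->
  zsum N (fun x => f x * Hk k g x) = zsum N (fun x => g x * Hk k f x).
Proof.
intros Hf Hg; apply Rminus_diag_uniq; rewrite zsum_Hk_sym; unfold boundary.
rewrite !(Hf (Z.of_nat (S N))), !(Hg (Z.of_nat (S N))), !(Hf (- Z.of_nat (S N))%Z),
  !(Hg (- Z.of_nat (S N))%Z) by lia; ring.
Qed.

(** The larger window on the right is needed for the bond from -N - 1 to -N, whose energy f(-N)^2 is
    the boundary term. *)
Lemma zsum_Hk_supp (k : R) (N : nat) (f : Z -> R) : supp N f ->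
  zsum N (fun x => f x * Hk k f x) = zsum (S N) (hform k f).
Proof.
intros Hf; rewrite zsum_Hk_diag; cbn [zsum]; unfold boundary, hform.
replace (- Z.of_nat (S N) + 1)%Z with (- Z.of_nat N)%Z by lia.
rewrite !(Hf (Z.of_nat (S N))), !(Hf (Z.of_nat (S N) + 1)%Z), !(Hf (- Z.of_nat (S N))%Z) by lia; ring.
Qed.

Lemma zsum_Hk_supp_ge (k : R) (N : nat) (f : Z -> R) : supp N f ->
  k ^ 4 * zsum N (fun x => IZR x ^ 2 * f x ^ 2) <= zsum N (fun x => f x * Hk k f x).
Proof.
intros Hf; rewrite zsum_Hk_supp by easy.
apply Rle_trans with (zsum N (hform k f)).
- rewrite <- zsum_scal; apply zsum_le; intros x _; unfold hform.
  pose proof (pow2_ge_0 (f (x + 1)%Z - f x)); lra.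
- apply zsum_window_le; [lia|apply hform_ge0].
Qed.

Lemma linear_dominated_by_square (b q : R) : (forall t, 0 <= 2 * t * b + t ^ 2 * q) -> b = 0.
Proof.
intros H; destruct (Req_dec b 0) as [|hb]; [easy|exfalso].
assert (hb2 : 0 < b ^ 2) by now apply pow2_gt_0.
assert (hq : 0 < Rabs q + 1) by (pose proof (Rabs_pos q); lra).
specialize (H (- b / (Rabs q + 1))).
replace (2 * (- b / (Rabs q + 1)) * b + (- b / (Rabs q + 1)) ^ 2 * q)
  with (b ^ 2 / (Rabs q + 1) ^ 2 * (q - 2 * (Rabs q + 1))) in H by (field; lra).
assert (0 < b ^ 2 / (Rabs q + 1) ^ 2) by (apply Rdiv_lt_0_compat; [easy|now apply pow_lt]).
assert (q <= Rabs q) by apply Rle_abs.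
assert (q - 2 * (Rabs q + 1) < 0) by (pose proof (Rabs_pos q); lra).
nra.
Qed.

Lemma ulim_Hk (U : (nat -> Prop) -> Prop) (k : R) (F : nat -> Z -> R) (f : Z -> R) (x : Z) :
  free_ultrafilter U -> (forall y, ulim U (fun p => F p y) (f y)) ->
  ulim U (fun p => Hk k (F p) x) (Hk k f x).
Proof.
intros HU HF.
assert (H : ulim U (fun p => (2 + k ^ 4 * IZR x ^ 2) * F p x
    + -1 * (F p (x + 1)%Z + F p (x - 1)%Z))
  ((2 + k ^ 4 * IZR x ^ 2) * f x + -1 * (f (x + 1)%Z + f (x - 1)%Z))).
{ apply ulim_plus; [easy| |]; (apply ulim_mult; [easy|now apply ulim_const|]).
  - apply HF.
  - now apply ulim_plus. }
replace (Hk k f x) with ((2 + k ^ 4 * IZR x ^ 2) * f x + -1 * (f (x + 1)%Z + f (x - 1)%Z))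
  by (unfold Hk; ring).
apply (ulim_ext U _ _ _ O HU) with (2 := H). intros p _; unfold Hk; ring.
Qed.

(** Direct method on the unit sphere of a finite-dimensional space: everything lives on |x| <= N, so
    pointwise limits along an ultrafilter preserve the norm, the constraints and the form. The
    vector h0 guarantees that the sphere is non-empty. *)
Lemma constrained_minimum (k : R) (N m : nat) (e : nat -> Z -> R) (h0 : Z -> R) :
  let feasible f := supp N f /\ forall i, (i < m)%nat -> zsum N (fun x => f x * e i x) = 0 in
  feasible h0 -> 0 < zsum N (fun x => h0 x ^ 2) ->
  exists f, feasible f /\ zsum N (fun x => f x ^ 2) = 1 /\
    forall g, feasible g -> zsum N (fun x => f x * Hk k f x) * zsum N (fun x => g x ^ 2)
      <= zsum N (fun x => g x * Hk k g x).
Proof.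
intros feasible Hh0 Hpos.
set (q := fun f => zsum N (fun x => f x * Hk k f x)).
assert (Hq0 : forall f, feasible f -> 0 <= q f).
{ intros f [Hf _]; unfold q; rewrite zsum_Hk_supp by easy; apply zsum_ge0; intros; apply hform_ge0. }
assert (Hnorm : forall g, feasible g -> 0 < zsum N (fun x => g x ^ 2) ->
  exists f, feasible f /\ zsum N (fun x => f x ^ 2) = 1 /\ q g = q f * zsum N (fun x => g x ^ 2)).
{ intros g [Hg Hge] Hg2; set (S2 := zsum N (fun x => g x ^ 2)) in *.
  assert (Hr : 0 < sqrt S2) by now apply sqrt_lt_R0.
  assert (Hr2 : sqrt S2 * sqrt S2 = S2) by (apply sqrt_sqrt; lra).
  exists (fun x => / sqrt S2 * g x); split; [split|split].
  - intros x Hx; rewrite Hg by easy; ring.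
  - intros i Hi; rewrite (zsum_ext N _ (fun x => / sqrt S2 * (g x * e i x))) by (intros; ring).
    rewrite zsum_scal, Hge by easy; ring.
  - rewrite (zsum_ext N _ (fun x => (/ sqrt S2 * / sqrt S2) * g x ^ 2)) by (intros; ring).
    rewrite zsum_scal; fold S2. rewrite <- Rinv_mult, Hr2; field; lra.
  - unfold q; rewrite (zsum_ext N (fun x => / sqrt S2 * g x * _)
      (fun x => (/ sqrt S2 * / sqrt S2) * (g x * Hk k g x))) by (intros; unfold Hk; ring).
    rewrite zsum_scal, <- Rinv_mult, Hr2; field; lra. }
(* [V] collects the values of -q, so that its supremum M gives the infimum -M of q. *)
set (V := fun c => exists f, feasible f /\ zsum N (fun x => f x ^ 2) = 1 /\ c = - q f).
destruct (completeness V) as [M [Hub Hlub]].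
{ exists 0; intros c (f & Hf & _ & ->); specialize (Hq0 f Hf); lra. }
{ destruct (Hnorm h0 Hh0 Hpos) as (f & Hf & Hf1 & _); exists (- q f), f; easy. }
assert (Hseq : forall p : nat, exists f, feasible f /\ zsum N (fun x => f x ^ 2) = 1 /\
   q f <= - M + / (INR p + 1)).
{ intros p; apply NNPP; intros Hno.
  assert (Hp : 0 < / (INR p + 1)) by (apply Rinv_0_lt_compat; pose proof (pos_INR p); lra).
  assert (M <= M - / (INR p + 1)); [|lra].
  apply Hlub; intros c (f & Hf & Hf1 & ->).
  apply Rnot_lt_le; intros Hlt; apply Hno; exists f; repeat split; try apply Hf; try easy; lra. }
set (F := fun p => proj1_sig (constructive_indefinite_description _ (Hseq p))).
assert (HF : forall p, feasible (F p) /\ zsum N (fun x => F p x ^ 2) = 1 /\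
   q (F p) <= - M + / (INR p + 1)).
{ intros p; exact (proj2_sig (constructive_indefinite_description _ (Hseq p))). }
clearbody F; clear Hseq.
destruct free_ultrafilter_exists as [U HU].
assert (Hlim : forall x, exists l, ulim U (fun p => F p x) l).
{ intros x; apply ulim_bounded with 1; [easy|]; intros p.
  destruct (HF p) as ([Hs _] & H1 & _).
  destruct (Z_lt_le_dec (Z.of_nat N) (Z.abs x)) as [h|h].
  - rewrite Hs, Rabs_R0 by easy; lra.
  - assert (H2 := zsum_term_le N (fun x => F p x ^ 2) x h (fun y => pow2_ge_0 _)).
    cbv beta in H2; rewrite H1 in H2. apply Rabs_le; nra. }
set (f := fun x => proj1_sig (constructive_indefinite_description _ (Hlim x))).
assert (Hf : forall x, ulim U (fun p => F p x) (f x)).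
{ intros x; exact (proj2_sig (constructive_indefinite_description _ (Hlim x))). }
clearbody f; clear Hlim.
assert (Hff : feasible f).
{ split.
  - intros x Hx; apply (ulim_unique U (fun p => F p x)); [easy|easy|].
    apply (ulim_ext U (fun _ => 0) _ _ O HU); [|now apply ulim_const].
    intros p _; destruct (HF p) as ([Hs _] & _); now rewrite Hs.
  - intros i Hi; apply (ulim_unique U (fun p => zsum N (fun x => F p x * e i x))); [easy| |].
    + apply (ulim_zsum U N (fun p x => F p x * e i x)); [easy|].
      intros x; apply ulim_mult; [easy|apply Hf|now apply ulim_const].
    + apply (ulim_ext U (fun _ => 0) _ _ O HU); [|now apply ulim_const].
      intros p _; destruct (HF p) as ([_ He] & _); now rewrite He. }
assert (Hf1 : zsum N (fun x => f x ^ 2) = 1).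
{ apply (ulim_unique U (fun p => zsum N (fun x => F p x ^ 2))); [easy| |].
  - apply (ulim_zsum U N (fun p x => F p x ^ 2)); [easy|].
    intros x; now apply ulim_sq.
  - apply (ulim_ext U (fun _ => 1) _ _ O HU); [|now apply ulim_const].
    intros p _; now destruct (HF p) as (_ & -> & _). }
assert (HqM : forall g, feasible g -> zsum N (fun x => g x ^ 2) = 1 -> - M <= q g).
{ intros g Hg Hg1; assert (- q g <= M); [apply Hub; now exists g|lra]. }
assert (Hqlim : ulim U (fun p => q (F p)) (q f)).
{ apply (ulim_zsum U N (fun p x => F p x * Hk k (F p) x)); [easy|].
  intros x; apply ulim_mult; [easy|apply Hf|now apply ulim_Hk]. }
assert (Hqf : q f <= - M).
{ apply le_epsilon; intros eps Heps.
  destruct (archimed_cor1 eps Heps) as (p0 & Hp0 & Hp0').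
  apply (ulim_le U _ _ _ _ p0 HU) with (2 := Hqlim) (3 := ulim_const U (- M + eps) HU).
  intros p Hp; destruct (HF p) as (_ & _ & H3).
  assert (0 < INR p0) by now apply lt_0_INR.
  assert (/ (INR p + 1) <= / INR p0); [|lra].
  apply Rinv_le_contravar; [easy|]. apply le_INR in Hp; lra. }
exists f; split; [easy|split; [easy|]].
intros g Hg; fold (q f) (q g).
destruct (Rle_lt_or_eq_dec 0 (zsum N (fun x => g x ^ 2))) as [h|h].
- apply zsum_ge0; intros; apply pow2_ge_0.
- destruct (Hnorm g Hg h) as (f' & Hf' & Hf1' & ->).
  apply Rmult_le_compat_r; [lra|]. specialize (HqM f' Hf' Hf1'); lra.
- rewrite <- h, Rmult_0_r; now apply Hq0.
Qed.

Definition delta (i l : nat) : R := if (i =? l)%nat then 1 else 0.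

(** An orthonormal eigensystem of the Dirichlet truncation: each vector is zero outside the window,
    and the eigenvalue equation is imposed inside it only. *)
Definition eigensystem (k : R) (N : nat) (lam : R) (m : nat) (e : nat -> Z -> R) (mu : nat -> R) : Prop :=
  (forall i, (i < m)%nat -> supp N (e i) /\ mu i <= lam /\
     forall x, (Z.abs x <= Z.of_nat N)%Z -> Hk k (e i) x = mu i * e i x) /\
  forall i l, (i < m)%nat -> (l < m)%nat -> zsum N (fun x => e i x * e l x) = delta i l.

(** The next eigenvector minimises the form on the orthogonal complement of the previous ones; the
    trial vector h0 keeps its eigenvalue below lam. *)
Lemma eigensystem_step (k : R) (N : nat) (lam : R) (m : nat) (e : nat -> Z -> R) (mu : nat -> R)
    (h0 : Z -> R) :
  eigensystem k N lam m e mu -> supp N h0 ->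
  (forall i, (i < m)%nat -> zsum N (fun x => h0 x * e i x) = 0) ->
  0 < zsum N (fun x => h0 x ^ 2) ->
  zsum N (fun x => h0 x * Hk k h0 x) <= lam * zsum N (fun x => h0 x ^ 2) ->
  exists e' mu', eigensystem k N lam (S m) e' mu'.
Proof.
intros [He Hon] Hs Ho Hpos Hq.
destruct (constrained_minimum k N m e h0) as (f & [Hf Hfe] & Hf1 & Hmin); [easy|easy|].
set (nu := zsum N (fun x => f x * Hk k f x)) in *.
assert (Hnu : nu <= lam).
{ apply (Rmult_le_reg_r (zsum N (fun x => h0 x ^ 2))); [easy|].
  eapply Rle_trans; [now apply Hmin|easy]. }
(* The residual is itself orthogonal to the e_i, hence an admissible direction. *)
set (r := fun x => if (Z.abs x <=? Z.of_nat N)%Z then Hk k f x - nu * f x else 0).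
assert (Hr : supp N r).
{ intros x Hx; unfold r; destruct (Z.leb_spec (Z.abs x) (Z.of_nat N)); [lia|easy]. }
assert (Hrin : forall x, (Z.abs x <= Z.of_nat N)%Z -> r x = Hk k f x - nu * f x).
{ intros x Hx; unfold r; destruct (Z.leb_spec (Z.abs x) (Z.of_nat N)); [easy|lia]. }
assert (Hre : forall i, (i < m)%nat -> zsum N (fun x => r x * e i x) = 0).
{ intros i Hi. destruct (He i Hi) as (Hei & _ & Eei).
  rewrite (zsum_ext N _ (fun x => e i x * Hk k f x + - nu * (f x * e i x)))
    by (intros; rewrite Hrin by easy; ring).
  rewrite zsum_plus, zsum_scal, Hfe, (zsum_Hk_supp_sym k N (e i) f) by easy.
  rewrite (zsum_ext N _ (fun x => mu i * (f x * e i x))) by (intros; rewrite Eei by easy; ring).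
  rewrite zsum_scal, Hfe by easy; ring. }
assert (Hrr : zsum N (fun x => r x ^ 2) = 0).
(* Along f + t r the form minus nu times the squared norm is non-negative and zero at t = 0; its
   linear coefficient is 2 |r|^2. *)
{ apply (linear_dominated_by_square _ (zsum N (fun x => r x * Hk k r x) - nu * zsum N (fun x => r x ^ 2))).
  intros t.
  assert (H := Hmin (fun x => f x + t * r x)).
  assert (E1 : zsum N (fun x => (f x + t * r x) ^ 2)
    = 1 + 2 * t * zsum N (fun x => r x * f x) + t ^ 2 * zsum N (fun x => r x ^ 2)).
  { rewrite <- Hf1, <- 2!zsum_scal, <- 2!zsum_plus; apply zsum_ext; intros; ring. }
  assert (E2 : zsum N (fun x => (f x + t * r x) * Hk k (fun x => f x + t * r x) x)
    = nu + 2 * t * zsum N (fun x => r x * Hk k f x) + t ^ 2 * zsum N (fun x => r x * Hk k r x)).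
  { replace (2 * t * zsum N (fun x => r x * Hk k f x)) with
      (t * zsum N (fun x => r x * Hk k f x) + t * zsum N (fun x => f x * Hk k r x))
      by (rewrite (zsum_Hk_supp_sym k N f r) by easy; ring).
    unfold nu; rewrite <- 3!zsum_scal, <- 3!zsum_plus; apply zsum_ext; intros; unfold Hk; ring. }
  assert (E3 : zsum N (fun x => r x ^ 2)
    = zsum N (fun x => r x * Hk k f x) - nu * zsum N (fun x => r x * f x)).
  { rewrite <- zsum_scal, <- zsum_minus; apply zsum_ext; intros x Hx. rewrite !Hrin by easy; ring. }
  cbv beta in H; rewrite E1, E2 in H.
  assert (H' : nu * (1 + 2 * t * zsum N (fun x => r x * f x) + t ^ 2 * zsum N (fun x => r x ^ 2))
    <= nu + 2 * t * zsum N (fun x => r x * Hk k f x) + t ^ 2 * zsum N (fun x => r x * Hk k r x)).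
  { apply H; split.
    - intros x Hx; rewrite Hf, Hr by easy; ring.
    - intros i Hi; rewrite (zsum_ext N _ (fun x => f x * e i x + t * (r x * e i x))) by (intros; ring).
      rewrite zsum_plus, zsum_scal, Hfe, Hre by easy; ring. }
  rewrite E3 at 1. lra. }
exists (fun i => if (i =? m)%nat then f else e i), (fun i => if (i =? m)%nat then nu else mu i).
split.
- intros i Hi; destruct (Nat.eqb_spec i m) as [->|]; [|apply He; lia].
  split; [easy|split; [easy|]]. intros x Hx.
  assert (r x ^ 2 = 0)
    by (apply (zsum_term_eq0 N (fun x => r x ^ 2)); [easy|intros; apply pow2_ge_0|easy]).
  assert (Hrx := Hrin x Hx). assert (r x = 0) by nra. lra.
- intros i l Hi Hl. unfold delta.
  destruct (Nat.eqb_spec i m) as [->|Hi'], (Nat.eqb_spec l m) as [->|Hl'].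
  + rewrite Nat.eqb_refl, <- Hf1; apply zsum_ext; intros; ring.
  + destruct (Nat.eqb_spec m l); [lia|]. apply Hfe; lia.
  + destruct (Nat.eqb_spec i m); [lia|]. rewrite <- (Hfe i) by lia. apply zsum_ext; intros; ring.
  + apply Hon; lia.
Qed.

Lemma eigensystem_exists (k : R) (N : nat) (lam : R) (n : nat) (g : nat -> Z -> R) :
  (forall i, (i <= n)%nat -> supp N (g i)) ->
  (forall c : nat -> R, (exists i, (i <= n)%nat /\ c i <> 0) ->
    let u := fun x => sumn (S n) (fun i => c i * g i x) in
    0 < zsum N (fun x => u x ^ 2) /\
    zsum N (fun x => u x * Hk k u x) <= lam * zsum N (fun x => u x ^ 2)) ->
  exists e mu, eigensystem k N lam (S n) e mu.
Proof.
intros Hg Hu.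
assert (H : forall m, (m <= S n)%nat -> exists e mu, eigensystem k N lam m e mu).
{ induction m as [|m IH]; intros Hm.
  { exists g, (fun _ => 0); split; intros; lia. }
  destruct (IH ltac:(lia)) as (e & mu & He).
  (* Rows l >= m are filled with zeros, so one system with n rows serves every m <= n. *)
  destruct (linear_system_nontrivial n
    (fun l i => if (l <? m)%nat then zsum N (fun x => g i x * e l x) else 0)) as (c & Hc0 & Hc).
  destruct (Hu c Hc0) as [Hpos Hq].
  apply (eigensystem_step k N lam m e mu (fun x => sumn (S n) (fun i => c i * g i x))); try easy.
  - apply supp_sumn; intros i Hi x Hx; rewrite Hg by lia || easy; ring.
  - intros l Hl. rewrite <- (Hc l) by lia.
    rewrite (zsum_ext N _ (fun x => sumn (S n) (fun i => c i * (g i x * e l x)))).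
    + rewrite zsum_sumn; apply sumn_ext; intros i Hi.
      destruct (Nat.ltb_spec l m); [|lia]. rewrite zsum_scal; ring.
    + intros x _; rewrite Rmult_comm, <- sumn_scal; apply sumn_ext; intros; ring. }
now apply H.
Qed.

(** * Removing the truncation *)

Lemma ex_series_sq_bounded (a : nat -> R) (M : R) :
  (forall N, sum_n (fun i => a i ^ 2) N <= M) -> ex_series (fun i => a i ^ 2).
Proof.
intros H; destruct (ex_finite_lim_seq_incr (sum_n (fun i => a i ^ 2)) M) as [l Hl].
- intros p; rewrite sum_Sn. pose proof (pow2_ge_0 (a (S p))); unfold plus; simpl in *; lra.
- easy.
- now exists l.
Qed.

Lemma l2_bounded (f : Z -> R) (M : R) : (forall N, zsum N (fun x => f x ^ 2) <= M) -> l2 f.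
Proof.
intros H; split; apply (ex_series_sq_bounded _ M); intros N; (eapply Rle_trans; [|apply (H N)]).
- induction N as [|N IH]; [rewrite sum_O; simpl; lra|].
  rewrite sum_Sn; cbn [zsum].
  pose proof (pow2_ge_0 (f (- Z.of_nat (S N))%Z)); unfold plus; simpl in *; lra.
- induction N as [|N IH]; [rewrite sum_O; simpl; lra|].
  rewrite sum_Sn; cbn [zsum].
  pose proof (pow2_ge_0 (f (Z.of_nat (S N)))); unfold plus; simpl in *; lra.
Qed.

Lemma inv_sq_lim0 (C : R) : is_lim_seq (fun w => C / INR (S w) ^ 2) 0.
Proof.
apply is_lim_seq_ext with (fun w => C * (/ INR (S w) * / INR (S w))).
{ intros w; assert (0 < INR (S w)) by (apply lt_0_INR; lia). field; lra. }
apply is_lim_seq_scal0. replace 0 with (0 * 0) by ring.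
assert (H : is_lim_seq (fun w => / INR (S w)) 0).
{ apply (is_lim_seq_incr_1 (fun w => / INR w)).
  replace (Finite 0) with (Rbar_inv p_infty) by easy.
  apply is_lim_seq_inv; [apply is_lim_seq_INR|easy]. }
now apply is_lim_seq_mult'.
Qed.

(** The energy bounds the sum of x^2 e(x)^2 by lam / k^4, so the mass beyond S W is at most that
    over (S W)^2. The bound does not depend on N and therefore survives the limit; the successor
    keeps the denominator non-zero. *)
Lemma eigensystem_tight (k lam : R) (m N W : nat) (e : nat -> Z -> R) (mu : nat -> R) (i l : nat) :
  0 < k -> eigensystem k N lam m e mu -> (i < m)%nat -> (l < m)%nat -> (S W <= N)%nat ->
  Rabs (zsum (S W) (fun x => e i x * e l x) - delta i l) <= lam / k ^ 4 / INR (S W) ^ 2.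
Proof.
intros Hk0 [He Hon] Hi Hl HW.
assert (Hk4 : 0 < k ^ 4) by now apply pow_lt.
assert (HW0 : 0 < INR (S W)) by (apply lt_0_INR; lia).
assert (HW2 : 0 < INR (S W) ^ 2) by now apply pow_lt.
assert (Hmass : forall p, (p < m)%nat -> zsum N (fun x => IZR x ^ 2 * e p x ^ 2) <= lam / k ^ 4).
{ intros p Hp; destruct (He p Hp) as (Hs & Hmu & E).
  apply Rle_div_r; [easy|]. rewrite Rmult_comm.
  eapply Rle_trans; [now apply zsum_Hk_supp_ge|].
  rewrite (zsum_ext N _ (fun x => mu p * (e p x * e p x))) by (intros; rewrite E by easy; ring).
  rewrite zsum_scal, Hon by easy. unfold delta; rewrite Nat.eqb_refl; lra. }
rewrite <- Hon by easy. rewrite Rabs_minus_sym.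
(* [h] dominates |e_i e_l| beyond S W: the product is at most half the sum of squares, and there x^2
   / (S W)^2 >= 1. *)
set (h := fun x => / (2 * INR (S W) ^ 2) * (IZR x ^ 2 * e i x ^ 2 + IZR x ^ 2 * e l x ^ 2)).
assert (Hh0 : forall x, 0 <= h x).
{ intros x; apply Rmult_le_pos; [apply Rlt_le, Rinv_0_lt_compat; lra|].
  pose proof (pow2_ge_0 (IZR x)); pose proof (pow2_ge_0 (e i x)); pose proof (pow2_ge_0 (e l x)).
  apply Rplus_le_le_0_compat; now apply Rmult_le_pos. }
eapply Rle_trans; [apply (zsum_window_diff (S W) N _ h HW)|].
- intros x Hx.
  assert (Hx2 : INR (S W) ^ 2 <= IZR x ^ 2).
  { rewrite <- (pow2_abs (IZR x)), <- abs_IZR, INR_IZR_INZ.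
    apply pow_incr; split; apply IZR_le; lia. }
  assert (Hab : Rabs (e i x * e l x) <= (e i x ^ 2 + e l x ^ 2) / 2).
  { pose proof (pow2_ge_0 (e i x - e l x)); pose proof (pow2_ge_0 (e i x + e l x)).
    apply Rabs_le; lra. }
  eapply Rle_trans; [exact Hab|]. unfold h.
  rewrite <- Rmult_plus_distr_l.
  apply (Rmult_le_reg_l (2 * INR (S W) ^ 2)); [lra|].
  rewrite <- Rmult_assoc, Rinv_r, Rmult_1_l by lra.
  assert (0 <= e i x ^ 2 + e l x ^ 2) by (pose proof (pow2_ge_0 (e i x)); pose proof (pow2_ge_0 (e l x)); lra).
  replace (2 * INR (S W) ^ 2 * ((e i x ^ 2 + e l x ^ 2) / 2))
    with (INR (S W) ^ 2 * (e i x ^ 2 + e l x ^ 2)) by field.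
  now apply Rmult_le_compat_r.
- assert (0 <= zsum (S W) h) by now apply zsum_ge0.
  assert (zsum N h <= lam / k ^ 4 / INR (S W) ^ 2); [|lra].
  unfold h; rewrite zsum_scal, zsum_plus.
  replace (lam / k ^ 4 / INR (S W) ^ 2) with (/ (2 * INR (S W) ^ 2) * (lam / k ^ 4 + lam / k ^ 4))
    by (field; lra).
  apply Rmult_le_compat_l; [apply Rlt_le, Rinv_0_lt_compat; lra|].
  apply Rplus_le_compat; now apply Hmass.
Qed.

(** Pairing a vanishing combination with f_l on a window makes the combined Gram error equal to the
    constant -c_l, yet that error tends to 0. *)
Lemma lin_indep_asymptotically_orthonormal (n : nat) (f : nat -> Z -> R) :
  (forall i l, (i <= n)%nat -> (l <= n)%nat ->
    is_lim_seq (fun W => zsum (S W) (fun x => f i x * f l x) - delta i l) 0) ->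
  lin_indep n f.
Proof.
intros H c Hc l Hl.
assert (Hlim : is_lim_seq (fun W => sumn (S n) (fun i =>
   c i * (zsum (S W) (fun x => f i x * f l x) - delta i l))) 0).
{ apply is_lim_seq_sumn0; intros i Hi; apply is_lim_seq_scal0, H; lia. }
apply (is_lim_seq_ext _ (fun _ => - c l)) in Hlim.
- apply is_lim_seq_unique in Hlim; rewrite Lim_seq_const in Hlim.
  injection Hlim; lra.
- intros W.
  rewrite (sumn_ext (S n) _ (fun i => zsum (S W) (fun x => c i * (f i x * f l x))
    + -1 * (c i * delta i l))) by (intros; rewrite zsum_scal; ring).
  rewrite sumn_plus, sumn_scal, <- zsum_sumn.
  rewrite (sumn_single (S n) l (fun i => c i * delta i l)); [|lia|].
  + rewrite zsum_zero.
    * unfold delta; rewrite Nat.eqb_refl; ring.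
    * intros x _.
      transitivity (f l x * sumn (S n) (fun i => c i * f i x)).
      -- rewrite <- sumn_scal; apply sumn_ext; intros; ring.
      -- rewrite <- sum_f_R0_sumn, Hc; ring.
  + intros i Hi Hil; unfold delta; destruct (Nat.eqb_spec i l); [easy|ring].
Qed.

(** Eigenvectors and eigenvalues of the truncations converge pointwise along an ultrafilter. The
    equation is local and passes to the limit at each x; tightness keeps the limits orthonormal on
    growing windows, hence non-zero and independent. *)
Lemma eigensystems_count_ge (k lam : R) (n : nat) : 0 < k ->
  (exists j, forall p, exists e mu, eigensystem k (j + p) lam (S n) e mu) ->
  count_ge k n lam.
Proof.
intros Hk0 [j Hj].
assert (Hch : exists (e : nat -> nat -> Z -> R) (mu : nat -> nat -> R),
  forall p, eigensystem k (j + p) lam (S n) (e p) (mu p)).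
{ set (em := fun p => constructive_indefinite_description _ (Hj p)).
  set (ex := fun p => constructive_indefinite_description _ (proj2_sig (em p))).
  exists (fun p => proj1_sig (em p)), (fun p => proj1_sig (ex p)); intros p.
  exact (proj2_sig (ex p)). }
destruct Hch as (e & mu & He).
assert (Hsq : forall p i W, (i <= n)%nat -> (W <= p)%nat -> zsum W (fun x => e p i x ^ 2) <= 1).
{ intros p i W Hi HW; destruct (He p) as [_ Hon].
  specialize (Hon i i ltac:(lia) ltac:(lia)); unfold delta in Hon; rewrite Nat.eqb_refl in Hon.
  rewrite <- Hon, (zsum_ext (j + p) _ (fun x => e p i x ^ 2)) by (intros; ring).
  apply zsum_window_le; [lia|intros; apply pow2_ge_0]. }
assert (Hmu : forall p i, (i <= n)%nat -> 0 <= mu p i <= lam).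
{ intros p i Hi; destruct (He p) as [Hi' Hon].
  destruct (Hi' i ltac:(lia)) as (Hs & Hlam & E); split; [|easy].
  specialize (Hon i i ltac:(lia) ltac:(lia)); unfold delta in Hon; rewrite Nat.eqb_refl in Hon.
  assert (H0 := zsum_ge0 (S (j + p)) _ (fun x _ => hform_ge0 k (e p i) x)).
  rewrite <- zsum_Hk_supp in H0 by easy.
  rewrite (zsum_ext _ _ (fun x => mu p i * (e p i x * e p i x))) in H0
    by (intros; rewrite E by easy; ring).
  rewrite zsum_scal, Hon in H0; lra. }
destruct free_ultrafilter_exists as [U HU].
assert (Hf : exists f : nat -> Z -> R, forall i x, (i <= n)%nat -> ulim U (fun p => e p i x) (f i x)).
{ assert (H : forall i x, exists l, (i <= n)%nat -> ulim U (fun p => e p i x) l).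
  { intros i x; destruct (le_dec i n) as [h|h]; [|now exists 0].
    destruct (ulim_bounded U (fun p => e p i x) 1 HU) as [l Hl]; [|now exists l].
    intros p. assert (Habs : (e p i x) ^ 2 <= 1).
    { destruct (He p) as [Hs Hon].
      destruct (Z_lt_le_dec (Z.of_nat (j + p)) (Z.abs x)) as [h'|h'].
      - rewrite (proj1 (Hs i ltac:(lia)) x h'); lra.
      - specialize (Hon i i ltac:(lia) ltac:(lia)); unfold delta in Hon; rewrite Nat.eqb_refl in Hon.
        rewrite <- Hon, (zsum_ext _ _ (fun x => e p i x ^ 2)) by (intros; ring).
        apply (zsum_term_le _ (fun x => e p i x ^ 2)); [easy|intros; apply pow2_ge_0]. }
    apply Rabs_le; nra. }
  exists (fun i x => proj1_sig (constructive_indefinite_description _ (H i x))).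
  intros i x; exact (proj2_sig (constructive_indefinite_description _ (H i x))). }
destruct Hf as [f Hf].
assert (Hnu : exists nu : nat -> R, forall i, (i <= n)%nat -> ulim U (fun p => mu p i) (nu i)).
{ assert (H : forall i, exists l, (i <= n)%nat -> ulim U (fun p => mu p i) l).
  { intros i; destruct (le_dec i n) as [h|h]; [|now exists 0].
    destruct (ulim_bounded U (fun p => mu p i) lam HU) as [l Hl]; [|now exists l].
    intros p; specialize (Hmu p i h); apply Rabs_le; lra. }
  exists (fun i => proj1_sig (constructive_indefinite_description _ (H i))).
  intros i; exact (proj2_sig (constructive_indefinite_description _ (H i))). }
destruct Hnu as [nu Hnu].
assert (Horth : forall i l, (i <= n)%nat -> (l <= n)%nat ->
    is_lim_seq (fun W => zsum (S W) (fun x => f i x * f l x) - delta i l) 0).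
{ intros i l Hi Hl.
  assert (Hprod : forall W, ulim U (fun p => zsum (S W) (fun x => e p i x * e p l x) + - delta i l)
    (zsum (S W) (fun x => f i x * f l x) + - delta i l)).
  { intros W; apply ulim_plus; [easy| |now apply ulim_const].
    apply (ulim_zsum U (S W) (fun p x => e p i x * e p l x)); [easy|].
    intros x; apply ulim_mult; [easy|now apply Hf|now apply Hf]. }
  assert (Htight : forall W p, (S W <= p)%nat ->
    - (lam / k ^ 4 / INR (S W) ^ 2) <= zsum (S W) (fun x => e p i x * e p l x) + - delta i l
      <= lam / k ^ 4 / INR (S W) ^ 2).
  { intros W p Hp; apply Rabs_le_between.
    apply (eigensystem_tight k lam (S n) (j + p) W (e p) (mu p)); try easy; lia. }
  apply (is_lim_seq_le_le (fun W => -1 * (lam / k ^ 4 / INR (S W) ^ 2)) _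
    (fun W => lam / k ^ 4 / INR (S W) ^ 2)).
  - intros W; split.
    + apply (ulim_le U _ _ _ _ (S W) HU) with (2 := ulim_const U _ HU) (3 := Hprod W).
      intros p Hp; destruct (Htight W p Hp); lra.
    + apply (ulim_le U _ _ _ _ (S W) HU) with (2 := Hprod W) (3 := ulim_const U _ HU).
      intros p Hp; now destruct (Htight W p Hp).
  - apply is_lim_seq_scal0, inv_sq_lim0.
  - apply inv_sq_lim0. }
exists f, nu; split; [now apply lin_indep_asymptotically_orthonormal|].
intros i Hi; split; [split; [|split]|].
- apply (l2_bounded _ 1); intros W.
  apply (ulim_le U (fun p => zsum W (fun x => e p i x ^ 2)) (fun _ => 1) _ _ W HU);
    [now intros; apply Hsq| |now apply ulim_const].
  apply (ulim_zsum U W (fun p x => e p i x ^ 2)); [easy|].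
  intros x; apply ulim_sq; [easy|now apply Hf].
- apply not_all_not_ex; intros Hall.
  assert (H := Horth i i Hi Hi).
  apply (is_lim_seq_ext _ (fun _ => -1)) in H.
  + apply is_lim_seq_unique in H; rewrite Lim_seq_const in H; injection H; lra.
  + intros W; rewrite zsum_zero; [unfold delta; rewrite Nat.eqb_refl; ring|].
    intros x _; specialize (Hall x); apply NNPP in Hall; rewrite Hall; ring.
- intros x; apply (ulim_unique U (fun p => Hk k (e p i) x)); [easy| |].
  + apply ulim_Hk; [easy|]. intros y; now apply Hf.
  (* From p = |x| on, the point x lies in the window j + p, where the truncated equation holds. *)
  + apply (ulim_ext U (fun p => mu p i * e p i x) _ _ (Z.to_nat (Z.abs x)) HU).
    * intros p Hp; destruct (He p) as [Hs _].
      destruct (Hs i ltac:(lia)) as (_ & _ & E); symmetry; apply E; lia.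
    * apply ulim_mult; [easy|now apply Hnu|now apply Hf].
- apply (ulim_le U (fun p => mu p i) (fun _ => lam) _ _ O HU); [|now apply Hnu|now apply ulim_const].
  intros p _; now apply Hmu.
Qed.

(** * Upper bound and conclusion *)

(** The trial functions are cut-off Krawtchouk vectors; supported in [-j, j], they serve every
    truncation [-(j + p), j + p] alike. Positivity of 1 - 4 s^2 (2n + 1) says that the cutoff keeps
    a fraction of each norm, so the trial space retains its dimension. *)
Lemma count_ge_upper (n j : nat) (s Lam : R) :
  scaled s j -> (n <= 2 * j)%nat ->
  0 < 1 - 4 * s ^ 2 * (2 * INR n + 1) ->
  (1 + 4 * s) * (2 * INR n + 1) + 18 * s <= Lam * (1 - 4 * s ^ 2 * (2 * INR n + 1)) ->
  count_ge (s ^ 4) n (s ^ 8 * Lam).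
Proof.
intros H Hn Hpos HLam. set (a := 2 * INR n + 1) in *.
assert (Ha : 0 < a) by (unfold a; pose proof (pos_INR n); lra).
destruct (proj1 H) as [Hs0 Hs1].
assert (H8 : 0 < s ^ 8) by (now apply pow_lt).
apply eigensystems_count_ge; [now apply pow_lt|].
exists j; intros p; apply (eigensystem_exists _ _ _ n (fun i => cut s (zkvec j i))).
{ intros i _; apply (supp_le j); [lia|now apply cut_supp]. }
intros c Hc u. set (v := fun x => sumn (S n) (fun i => c i * zkvec j i x)).
assert (Hv : supp j v).
{ apply supp_sumn; intros i _ x Hx; rewrite zkvec_supp by easy; ring. }
assert (Huv : forall x, u x = cut s v x).
{ intros x; unfold u, v, cut; rewrite <- sumn_scal; apply sumn_ext; intros; ring. }
assert (Hu : supp j u) by (intros x Hx; rewrite Huv; now apply (cut_supp s j v H)).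
assert (Hv0 : 0 < zsum j (fun x => v x ^ 2)) by now apply zkvec_comb_pos.
destruct (cut_upper j s a v H Hv ltac:(lra) (kform_upper n j c Hn)) as [HQ HS].
rewrite (zsum_ext j (fun x => cut s v x ^ 2) (fun x => u x ^ 2)) in HS
  by (intros; now rewrite Huv).
rewrite (zsum_ext (S j) (hform (s ^ 4) (cut s v)) (hform (s ^ 4) u)) in HQ
  by (intros; unfold hform; now rewrite !Huv).
rewrite (zsum_support j (j + p) (fun x => u x ^ 2)); [|lia|intros; rewrite Hu by easy; ring].
rewrite (zsum_support j (j + p) (fun x => u x * Hk (s ^ 4) u x)); [|lia|intros; rewrite Hu by easy; ring].
rewrite zsum_Hk_supp by easy.
set (Sv := zsum j (fun x => v x ^ 2)) in *; set (Su := zsum j (fun x => u x ^ 2)) in *.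
split; [nra|].
eapply Rle_trans; [exact HQ|]. rewrite 2!Rmult_assoc; apply Rmult_le_compat_l; [lra|].
assert (HL0 : 0 <= Lam).
{ apply (Rmult_le_reg_r (1 - 4 * s ^ 2 * a)); [easy|]. nra. }
apply Rle_trans with (Lam * ((1 - 4 * s ^ 2 * a) * Sv)); [|now apply Rmult_le_compat_l].
rewrite <- Rmult_assoc; apply Rmult_le_compat_r; [lra|easy].
Qed.

Lemma scaled_spin (s : R) (n : nat) : 0 < s <= / 2 -> INR n * s <= 1 ->
  exists j, scaled s j /\ (n <= 2 * j)%nat.
Proof.
intros Hs Hn.
assert (H8 : 0 < s ^ 8) by (apply pow_lt; lra).
set (z := / s ^ 8).
assert (Hz : s ^ 8 * z = 1) by (unfold z; field; lra).
assert (Hz0 : 0 < z) by now apply Rinv_0_lt_compat.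
destruct (archimed z) as [Hu1 Hu2].
assert (Hup : (0 <= up z)%Z) by (apply le_IZR; lra).
(* As z < [up z] <= z + 1, the number j + 1/2 exceeds z = s^-8 by at most 3/2, within the tolerance
   2 s^8 of [scaled]. *)
exists (Z.to_nat (up z)).
assert (HJ : INR (Z.to_nat (up z)) = IZR (up z)) by (rewrite INR_IZR_INZ, Z2Nat.id; easy).
split; [split; [easy|]|].
- rewrite HJ; split; nra.
- assert (INR n <= INR (Z.to_nat (up z))); [|apply INR_le in H; lia].
  rewrite HJ. apply Rle_trans with z; [|lra].
  apply (Rmult_le_reg_l (s ^ 8)); [easy|]. rewrite Hz.
  apply Rle_trans with (INR n * s); [|easy]. rewrite Rmult_comm.
  apply Rmult_le_compat_l; [apply pos_INR|].
  assert (s ^ 8 <= s ^ 1) by (apply pow_le_base; [lra|lia]). simpl in *; lra.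
Qed.

(** A member and a lower bound make the infimum finite, so that [real] returns it and not the
    default value of an infinite argument. *)
Lemma E_bounds (n : nat) (k l u : R) :
  count_ge k n u -> (forall lam, count_ge k n lam -> l <= lam) -> l <= E n k <= u.
Proof.
intros Hu Hl; unfold E; destruct (Glb_Rbar_correct (count_ge k n)) as [Hlb Hglb].
specialize (Hlb u Hu); specialize (Hglb (Finite l) Hl).
destruct (Glb_Rbar (count_ge k n)); simpl in *; easy.
Qed.

Theorem theorem2p2 (n : nat) :
  filterlim (fun k : R => E n k / k ^ 2) (at_right 0) (locally (2 * INR n + 1)).
Proof.
set (a := 2 * INR n + 1).
assert (Ha : 1 <= a) by (unfold a; pose proof (pos_INR n); lra).
intros P [eps HP].
destruct eps as [eps Heps]; simpl in HP.
(* [C] dominates the coefficients of s in both error terms: a^2 + 4a + 18 + a eps/2 in the upper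
   bound, a^2 + 3a + 38 in the lower one. In [s0], the part 1 / (4a) gives s < 1/4, so that s^2 <=
   s/4, and keeps 1 - 4 s^2 a positive; the part eps / (2C) brings the error below eps/2. *)
set (C := 2 * a ^ 2 + 4 * a + 40 + a * eps).
assert (HC : 0 < C) by (unfold C; nra).
set (s0 := Rmin (/ (4 * a)) (eps / (2 * C))).
assert (Hs0 : 0 < s0).
{ apply Rmin_glb_lt; [apply Rinv_0_lt_compat; lra|apply Rdiv_lt_0_compat; lra]. }
assert (Hd : 0 < s0 ^ 4) by now apply pow_lt.
exists (mkposreal _ Hd); intros k Hk Hk0; simpl in Hk.
unfold ball in Hk; simpl in Hk; unfold AbsRing_ball, abs, minus, plus, opp in Hk; simpl in Hk.
rewrite Ropp_0, Rplus_0_r, Rabs_pos_eq in Hk by lra.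
change (s0 * (s0 * (s0 * (s0 * 1)))) with (s0 ^ 4) in Hk.
assert (Hs : exists s, 0 < s /\ s ^ 4 = k).
{ exists (sqrt (sqrt k)); split; [now repeat apply sqrt_lt_R0|].
  replace (sqrt (sqrt k) ^ 4) with ((sqrt (sqrt k) * sqrt (sqrt k)) * (sqrt (sqrt k) * sqrt (sqrt k))) by ring.
  rewrite !sqrt_sqrt by (try apply sqrt_pos; lra). easy. }
destruct Hs as (s & Hs & <-).
assert (Hss0 : s < s0).
{ apply Rnot_le_lt; intros h; assert (s0 ^ 4 <= s ^ 4) by (apply pow_incr; lra). lra. }
assert (Hsa : s * a < / 4).
{ apply Rlt_le_trans with (/ (4 * a) * a); [|right; field; lra].
  apply Rmult_lt_compat_r; [lra|]. eapply Rlt_le_trans; [exact Hss0|apply Rmin_l]. }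
assert (HsC : s * C < eps / 2).
{ apply Rlt_le_trans with (eps / (2 * C) * C); [|right; field; lra].
  apply Rmult_lt_compat_r; [lra|]. eapply Rlt_le_trans; [exact Hss0|apply Rmin_r]. }
assert (Hs4 : s < / 4) by nra.
assert (Hs2 : s ^ 2 <= s * / 4) by nra.
assert (H8 : 0 < s ^ 8) by now apply pow_lt.
assert (Hs8 : 2 * s ^ 8 <= s).
{ assert (s ^ 8 <= s ^ 2) by (apply pow_le_base; [lra|lia]). lra. }
destruct (scaled_spin s n ltac:(lra)) as (j & Hj & Hnj).
{ unfold a in Hsa; pose proof (pos_INR n); nra. }
assert (HE : s ^ 8 * (a - eps / 2) <= E n (s ^ 4) <= s ^ 8 * (a + eps / 2)).
{ apply E_bounds.
  - apply (count_ge_upper n j); [easy|easy|fold a; nra|fold a].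
    assert (h : s ^ 2 * (a * (a + eps / 2)) <= s * / 4 * (a * (a + eps / 2)))
      by (apply Rmult_le_compat_r; [nra|easy]).
    unfold C in HsC. nra.
  - intros lam Hlam; apply Rnot_lt_le; intros Hlt.
    assert (h := count_ge_lower n j s lam _ Hj Hnj Hlam Hlt); fold a in h.
    set (Lam := a - eps / 2) in *.
    assert (HLa : Lam <= a) by (unfold Lam; lra).
    assert (h1 : a - s * a ^ 2 <= a * (1 - 2 * s ^ 2 * Lam)).
    { assert (s ^ 2 * Lam <= s ^ 2 * a) by (apply Rmult_le_compat_l; [apply pow2_ge_0|easy]).
      nra. }
    assert (h2 : (1 + s) * Lam + 19 * s <= 2 * a + 19) by nra.
    assert (h3 : (1 + 2 * s ^ 8) * ((1 + s) * Lam + 19 * s)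
      <= Lam + s * a + 19 * s + s * (2 * a + 19)).
    { assert (2 * s ^ 8 * ((1 + s) * Lam + 19 * s) <= s * (2 * a + 19)).
      { apply Rle_trans with (2 * s ^ 8 * (2 * a + 19)); [apply Rmult_le_compat_l; lra|].
        apply Rmult_le_compat_r; lra. }
      nra. }
    assert (HC2 : s * (a ^ 2 + 3 * a + 38) <= s * C).
    { apply Rmult_le_compat_l; [lra|]. assert (0 < a * eps) by (apply Rmult_lt_0_compat; lra).
      unfold C; pose proof (pow2_ge_0 a); lra. }
    unfold Lam in *; lra. }
apply HP. unfold ball; simpl; unfold AbsRing_ball, abs, minus, plus, opp; simpl.
change (s * (s * (s * (s * 1)))) with (s ^ 4).
replace (s ^ 4 * (s ^ 4 * 1)) with (s ^ 8) by ring.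
assert (Hq : a - eps / 2 <= E n (s ^ 4) / s ^ 8 <= a + eps / 2).
{ split; [apply Rle_div_r|apply Rle_div_l]; lra. }
apply Rabs_def1; lra.
Qed.
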